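(* For every $\varepsilon>0$ there exists $n_0=n_0(\varepsilon)$ such that the following holds. Let $G$ be a simple $d$-regular graph on $n\ge n_0$ vertices, where $$2\le d\le n^{1/12-\varepsilon}.$$ Let $q=(q_0,\ldots,q_d)$ be a nonnegative integer vector satisfying $$\sum_{i=0}^d q_i=n,\qquad \sum_{i=0}^d i q_i\equiv 0\pmod 2,\qquad \left|q_i-\frac{n}{d+1}\right|\le 1\quad (0\le i\le d).$$ Then there exists a spanning subgraph $H\subseteq G$ such that $$m(H,i)=q_i\qquad (0\le i\le d).$$ Consequently, every such $G$ (simple, $d$-regular, on $n\ge n_0$ vertices with $2\le d\le n^{1/12-\varepsilon}$) has a spanning subgraph $H\subseteq G$ satisfying $$\left|m(H,i)-\frac{n}{d+1}\right|\le 1\qquad (0\le i\le d).$$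
   Context: All graphs are finite. For a spanning subgraph $H$ of a graph $G$ (i.e. $V(H)=V(G)$, $E(H)\subseteq E(G)$) and an integer $i\ge 0$, $m(H,i)=|\{v\in V(G): d_H(v)=i\}|$ is the number of vertices of degree $i$ in $H$. *)

(* Defs.v *)
From mathcomp Require Import all_boot all_order all_algebra.
From mathcomp Require Import reals exp.

Set Implicit Arguments.
Unset Strict Implicit.
Unset Printing Implicit Defensive.

(* A finite simple graph on the vertex set T is given by its adjacency
   relation. *)
Definition simple_graph (T : finType) (g : rel T) : Prop :=
  symmetric g /\ irreflexive g.

Definition deg (T : finType) (g : rel T) (v : T) : nat :=
  #|[set w | g v w]|.

Definition regular_graph (T : finType) (g : rel T) (d : nat) : Prop :=
  forall v : T, deg g v = d.

(* The shared vertex type T makes h spanning. *)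
Definition spanning_subgraph (T : finType) (h g : rel T) : Prop :=
  simple_graph h /\ subrel h g.

Definition degree_count (T : finType) (h : rel T) (i : nat) : nat :=
  #|[set v | deg h v == i]|.

(* Main.v *)
Require Import Defs.
From mathcomp Require Import all_boot all_order all_algebra all_fingroup.
From mathcomp Require Import reals exp.
From mathcomp Require Import zify ring lra.

(* Compare the degrees of a spanning subgraph h through its deficits
   S(c) = sum_v (c - deg v)^+, whose second differences are the degree counts.
   Give the vertices independent uniform levels x_v in [0, 1] (here in 'I_M) and
   keep the edge uv iff x_u + x_v > 1: the degree of v is then the rank of
   1 - x_v among d + 1 exchangeable values, hence uniform on 0, ..., d.  The
   fluctuations of S(c) have order d sqrt n.  To make every error have the same
   sign, some far-apart edges are made special: both ends get the same level, 0
   or 1 at random.  This spreads the degrees and pushes each S(c), 0 < c < d,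
   above its target, by more than the fluctuations.

   The surplus is removed by flipping vertex-disjoint edges.  Adding an edge
   between degrees j and k = d - 1 - j and deleting an edge between degrees
   j + 2 and k + 1 lowers S(j + 1) by one and changes no other S(c).  Both kinds
   of edges occur about n / d times: for an edge uv, the other neighbours of u
   (of v) leave with large probability a window of length about 1 / d in which
   the level of u (of v) produces the wanted degree, and the reflection
   x -> 1 - x exchanges the windows lying above and below the line
   x_u + x_v = 1. *)

Set Implicit Arguments.
Unset Strict Implicit.
Unset Printing Implicit Defensive.

Import Order.TTheory GRing.Theory Num.Theory.
Local Open Scope ring_scope.

(** * Averages over configurations *)

(** The exponent 1/12 comes from this count, up to constants and with s close to sqrt n. Controlling
    all d deficits at once by second moments allows errors lam of order d^2 s. A special edge may
    raise S(c) by as little as order 1 / d, at c = 1 or c = d - 1, so d^3 s special edges are used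
    to outweigh lam, and the surplus at each c can then reach order d^3 s. Removing it for every c
    takes d^4 s flips, each blocking order d edges, while a given pair of degrees is offered by only
    n / d edges. So d^5 s has to stay below n / d, that is d^12 below n; the factor n^(12 eps) pays
    for the constants.

    Errors of one sign are wanted because the reflection argument serves only the moves that lower
    S. There the edge to be deleted must have its levels pushed further above the line x_u + x_v =
    1, which is harmless. The opposite move would push a non-adjacent pair towards the line, where
    the symmetry gives no control. *)

Section Expectation.
Variables (R : realFieldType) (T : finType) (M : nat).
Hypothesis M_gt0 : (0 < M)%N.

Local Notation conf := {ffun T -> 'I_M}.

Definition expect (f : conf -> R) : R := (\sum_w f w) / #|{: conf}|%:R.

Definition upd (w : conf) (z : T) (a : 'I_M) : conf :=
  [ffun y => if y == z then a else w y].

(** The conditional expectation of [f] given all coordinates except [z]. *)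
Definition avg (z : T) (f : conf -> R) (w : conf) : R :=
  (\sum_(a < M) f (upd w z a)) / M%:R.

Lemma natr_levels_neq0 : M%:R != 0 :> R.
Proof. by rewrite pnatr_eq0 -lt0n. Qed.

Lemma card_conf_gt0 : (0 < #|{: conf}|)%N.
Proof. by apply/card_gt0P; exists [ffun=> Ordinal M_gt0]. Qed.

Lemma card_conf_neq0 : #|{: conf}|%:R != 0 :> R.
Proof. by rewrite pnatr_eq0 -lt0n card_conf_gt0. Qed.

Lemma eq_expect f f' : f =1 f' -> expect f = expect f'.
Proof. by move=> ff'; rewrite /expect (eq_bigr _ (fun w _ => ff' w)). Qed.

Lemma le_expect f f' : (forall w, f w <= f' w) -> expect f <= expect f'.
Proof.
by move=> ff'; rewrite ler_wpM2r ?invr_ge0 ?ler0n //; apply: ler_sum.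
Qed.

Lemma expect_cst c : expect (fun=> c) = c.
Proof.
rewrite /expect sumr_const -[_ *+ _]mulr_natr mulfK //; exact: card_conf_neq0.
Qed.

Lemma expectD f f' : expect (fun w => f w + f' w) = expect f + expect f'.
Proof. by rewrite /expect big_split mulrDl. Qed.

Lemma expectZ c f : expect (fun w => c * f w) = c * expect f.
Proof. by rewrite /expect -big_distrr mulrA. Qed.

Lemma expectB f f' : expect (fun w => f w - f' w) = expect f - expect f'.
Proof.
rewrite -[X in _ = _ + X]mulN1r -expectZ -expectD.
by apply: eq_expect => w; rewrite mulN1r.
Qed.

Lemma expect_sum (I : Type) (s : seq I) (P : pred I) (F : I -> conf -> R) :
  expect (fun w => \sum_(i <- s | P i) F i w) =
  \sum_(i <- s | P i) expect (F i).
Proof. by rewrite /expect exchange_big /= mulr_suml. Qed.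

Lemma expect_reindex (s : conf -> conf) f :
  bijective s -> expect (fun w => f (s w)) = expect f.
Proof.
move=> bs; rewrite /expect [in RHS](reindex s) //.
exact: onW_bij.
Qed.

Lemma exists_le_expect (f : conf -> R) c : expect f <= c -> exists w, f w <= c.
Proof.
move=> Ef; case: (boolP [exists w, f w <= c]) => [/existsP //|].
rewrite negb_exists => /forallP H; exfalso.
have h2: 0 < \sum_(w : conf) (f w - c).
  rewrite (bigD1 [ffun=> Ordinal M_gt0]) //= ltr_wpDr //.
    by apply: sumr_ge0 => w _; rewrite subr_ge0 ltW // ltNge H.
  by rewrite subr_gt0 ltNge H.
have h1 : expect (fun w => f w - c) <= 0 by rewrite expectB expect_cst subr_le0.
move: h1; rewrite /expect pmulr_lle0 ?invr_gt0 ?ltr0n ?card_conf_gt0 //.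
by rewrite leNgt h2.
Qed.

Lemma upd_at w z a : upd w z a z = a.
Proof. by rewrite ffunE eqxx. Qed.

Lemma upd_neq w z a y : y != z -> upd w z a y = w y.
Proof. by rewrite ffunE => /negPf ->. Qed.

Lemma expect_avg z f : expect (avg z f) = expect f.
Proof.
rewrite /expect /avg -mulr_suml; congr (_ / _).
rewrite pair_big /=.
(* Exchanging the old value at [z] with the fresh one is an involution on pairs, so resampling
   preserves the uniform measure. *)
pose phi (p : conf * 'I_M) : conf * 'I_M := (upd p.1 z p.2, p.1 z).
have phiK : involutive phi.
  case=> w a; rewrite /phi /= upd_at; congr pair; apply/ffunP=> y.
  by rewrite !ffunE; case: eqP => [->|].
rewrite (reindex phi) /=; last by apply: onW_bij; exists phi.
under eq_bigr => p _.
  rewrite (_ : upd _ _ _ = p.1); last first.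
    by rewrite -[p in RHS]phiK.
  over.
rewrite -(pair_bigA _ (fun (w : conf) (a : 'I_M) => f w)) /=.
under eq_bigr => w _ do rewrite sumr_const card_ord -mulr_natr.
by rewrite -mulr_suml mulfK // natr_levels_neq0.
Qed.

Lemma expect_coord z (f : 'I_M -> R) :
  expect (fun w => f (w z)) = (\sum_a f a) / M%:R.
Proof.
rewrite -(expect_avg z) -[RHS]expect_cst; apply: eq_expect => w.
by rewrite /avg; under eq_bigr do rewrite upd_at.
Qed.

Lemma avgM z f f' : (forall w a, f' (upd w z a) = f' w) ->
  forall w, avg z (fun w => f w * f' w) w = avg z f w * f' w.
Proof.
move=> hf w; rewrite /avg mulrAC; congr (_ / _); rewrite mulr_suml.
by apply: eq_bigr => a _; rewrite hf.
Qed.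

Lemma avg_upd z f w a : avg z f (upd w z a) = avg z f w.
Proof.
rewrite /avg; congr (_ / _); apply: eq_bigr => b _; congr f; apply/ffunP=> y.
by rewrite !ffunE; case: eqP.
Qed.

Definition bounded_diff (c : R) (f : conf -> R) :=
  forall z (w w' : conf), (forall y, y != z -> w y = w' y) -> `|f w - f w'| <= c.

Lemma avg_le z f w c : (forall a, f (upd w z a) <= c) -> avg z f w <= c.
Proof.
move=> hf; rewrite ler_pdivrMr ?ltr0n //.
apply: le_trans (ler_sum _ (fun a _ => hf a)) _.
by rewrite sumr_const card_ord mulr_natr.
Qed.

Lemma avgB z f f' w :
  avg z (fun w => f w - f' w) w = avg z f w - avg z f' w.
Proof. by rewrite /avg sumrB mulrBl. Qed.

Lemma avg_ge z f w c : (forall a, c <= f (upd w z a)) -> c <= avg z f w.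
Proof.
move=> hf; rewrite ler_pdivlMr ?ltr0n //.
apply: le_trans (ler_sum _ (fun a _ => hf a)).
by rewrite sumr_const card_ord mulr_natr.
Qed.

Lemma bounded_diff_avg z c f : bounded_diff c f -> bounded_diff c (avg z f).
Proof.
move=> bf x w w' ww'.
rewrite /avg -mulrBl -sumrB normrM normfV [`|M%:R|]normr_nat.
rewrite ler_pdivrMr ?ltr0n //; apply: le_trans (ler_norm_sum _ _ _) _.
have H a : `|f (upd w z a) - f (upd w' z a)| <= c.
  by apply: (bf x) => y yx; rewrite !ffunE; case: eqP => // _; apply: ww'.
apply: le_trans (ler_sum _ (fun a _ => H a)) _.
by rewrite sumr_const card_ord mulr_natr.
Qed.

(* Tensorization of the variance: averaging over one coordinate is an
   orthogonal projection, so it loses only the second moment of the difference. *)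
Lemma avg_sqr_le z c f : bounded_diff c f ->
  expect (fun w => f w ^+ 2) <= expect (fun w => avg z f w ^+ 2) + c ^+ 2.
Proof.
move=> bf.
have c0 : 0 <= c.
  by apply: le_trans (bf z [ffun=> Ordinal M_gt0] [ffun=> Ordinal M_gt0] _).
have cross : expect (fun w => f w * avg z f w) =
             expect (fun w => avg z f w ^+ 2).
  rewrite -(expect_avg z); apply: eq_expect => w.
  by rewrite avgM ?expr2 // => w' a; rewrite avg_upd.
rewrite -lerBlDl -[X in X <= _](_ : expect (fun w => (f w - avg z f w) ^+ 2) = _).
  rewrite -[leRHS]expect_cst; apply: le_expect => w.
  rewrite -real_normK ?num_real //; apply: lerXn2r; rewrite ?nnegrE ?normr_ge0 //.
  have -> : f w - avg z f w = avg z (fun w' => f w - f w') w.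
    rewrite avgB; congr (_ - _).
    by rewrite /avg sumr_const card_ord -[f w *+ _]mulr_natr mulfK ?natr_levels_neq0.
  have H a : `|f w - f (upd w z a)| <= c.
    by apply: (bf z) => y yz; rewrite upd_neq.
  rewrite ler_norml; apply/andP; split.
    by apply: avg_ge => a; have := H a; rewrite ler_norml => /andP[].
  by apply: avg_le => a; have := H a; rewrite ler_norml => /andP[].
transitivity (expect (fun w => f w ^+ 2) - 2 * expect (fun w => f w * avg z f w)
   + expect (fun w => avg z f w ^+ 2)); last by rewrite cross; ring.
rewrite -expectZ -expectB -expectD; apply: eq_expect => w; ring.
Qed.

(** An Efron-Stein bound: averaging out the coordinates one by one ends at the constant [expect f],
    and by [avg_sqr_le] each step loses at most c^2 of the second moment. *)
Lemma variance_le c f : bounded_diff c f ->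
  expect (fun w => (f w - expect f) ^+ 2) <= #|T|%:R * c ^+ 2.
Proof.
move=> bf.
pose F s := foldr avg f s.
have bF s : bounded_diff c (F s).
  by elim: s => //= z s; apply: bounded_diff_avg.
have EF s : expect (F s) = expect f by elim: s => //= z s <-; rewrite expect_avg.
have E2 s : expect (fun w => f w ^+ 2) <=
            expect (fun w => F s w ^+ 2) + (size s)%:R * c ^+ 2.
  elim: s => [|z s IH] /=; first by rewrite mul0r addr0.
  apply: le_trans IH _; rewrite -natr1 mulrDl mul1r [_ + c ^+ 2]addrC addrA lerD2r.
  exact: avg_sqr_le.
have cF s (w w' : conf) : (forall y, y \notin s -> w y = w' y) -> F s w = F s w'.
  elim: s w w' => [|z s IH] w w' ww' /=.
    by congr f; apply/ffunP => y; apply: ww'.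
  rewrite /avg; congr (_ / _); apply: eq_bigr => a _; apply: IH => y ys.
  by rewrite !ffunE; case: eqP => // /eqP yz; rewrite ww' // inE negb_or yz.
have FE w : F (enum T) w = expect f.
  rewrite -(EF (enum T)) -[LHS]expect_cst; apply: eq_expect => w'.
  by apply: cF => y; rewrite mem_enum.
have := E2 (enum T); rewrite -cardE.
rewrite [X in _ <= X + _](eq_expect (f' := fun=> expect f ^+ 2));
  last by move=> w; rewrite FE.
rewrite expect_cst => H.
rewrite (eq_expect (f' := fun w => f w ^+ 2 - (2 * expect f) * f w + expect f ^+ 2));
  last by move=> w; ring.
by rewrite expectD expectB expectZ expect_cst; lra.
Qed.

Lemma chebyshev c f (t : R) : bounded_diff c f -> 0 < t ->
  expect (fun w => (t <= `|f w - expect f|)%R%:R) <= #|T|%:R * c ^+ 2 / t ^+ 2.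
Proof.
move=> bf t0; rewrite ler_pdivlMr ?exprn_gt0 // mulrC -expectZ.
apply: le_trans (variance_le bf); apply: le_expect => w.
case: (leP t) => h; last by rewrite /= mulr0n mulr0 sqr_ge0.
rewrite /= mulr1n mulr1 -[leRHS]real_normK ?num_real //.
by apply: lerXn2r; rewrite ?nnegrE ?normr_ge0 ?(ltW t0).
Qed.

Lemma union_bound (I : finType) (P : pred I) (B : I -> pred conf) :
  \sum_(i | P i) expect (fun w => (B i w)%:R) < 1 ->
  exists w, forall i, P i -> ~~ B i w.
Proof.
rewrite -expect_sum => h.
have [w hw] := exists_le_expect (lexx (expect
  (fun w => \sum_(i | P i) (B i w)%:R))).
exists w => i Pi; apply/negP => Biw.
have := le_lt_trans hw h; rewrite (bigD1 i) //= Biw ltNge.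
by rewrite lerDl sumr_ge0.
Qed.

Definition rev_at (z : T) (w : conf) : conf := upd w z (rev_ord (w z)).

Lemma rev_atK z : involutive (rev_at z).
Proof.
by move=> w; apply/ffunP => y; rewrite !ffunE eqxx; case: eqP => [->|//]; rewrite rev_ordK.
Qed.

Lemma expect_rev_at z f : expect (fun w => f (rev_at z w)) = expect f.
Proof. by apply: expect_reindex; exists (rev_at z); apply: rev_atK. Qed.

(** For even [M], reversing the coordinate [u] exchanges the two outcomes, so they are equally
    likely; invariance of [f b] under this reversal plays the part of independence. *)
Lemma expect_coin u (f : bool -> conf -> R) : ~~ odd M ->
  (forall b w, f b (rev_at u w) = f b w) ->
  expect (fun w => f (2 * w u < M)%N w) = (expect (f true) + expect (f false)) / 2.
Proof.
move=> M_even fu; apply: (@mulIf _ 2); first by rewrite pnatr_eq0.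
rewrite divfK ?pnatr_eq0 // -expectD mulr_natr mulr2n.
rewrite -[X in X + _](expect_rev_at u) -expectD; apply: eq_expect => w.
rewrite fu /rev_at upd_at /=.
have -> : (2 * (M - (w u).+1) < M)%N = ~~ (2 * w u < M)%N.
  by have := ltn_ord (w u); lia.
by case: (_ < _)%N; rewrite //= addrC.
Qed.

Definition rev_all (w : conf) : conf := [ffun y => rev_ord (w y)].

Lemma expect_rev_all f : expect (fun w => f (rev_all w)) = expect f.
Proof.
by apply: expect_reindex; exists rev_all => w; apply/ffunP => y; rewrite !ffunE rev_ordK.
Qed.

Definition swap_coords (x y : T) (w : conf) : conf :=
  [ffun z => w (tperm x y z)].

Lemma expect_swap x y f : expect (fun w => f (swap_coords x y w)) = expect f.
Proof.
apply: expect_reindex; exists (swap_coords x y) => w; apply/ffunP => z;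
  by rewrite !ffunE tpermK.
Qed.

End Expectation.

(** * Ranks *)

(** Distinct values have ranks 0, ..., k - 1 and give equality; ties only lower the strict counts.
    The induction removes a minimal element, which no other strict rank counts. *)
Lemma sum_rank_ge (T : finType) (x : T -> nat) (c k : nat) (I : {set T}) :
  #|I| = k ->
  (\sum_(i < k) (c - i) <= \sum_(a in I) (c - #|[set z in I | x a < x z]|))%N.
Proof.
elim: k I => [|k IH] I cI; first by rewrite big_ord0.
have [a0 a0I] : exists a, a \in I by apply/card_gt0P; rewrite cI.
case: (@arg_minnP _ a0 (fun a => a \in I) x a0I) => a aI amin.
rewrite big_ord_recr /= (bigD1 a) //= addnC leq_add //.
  apply: leq_sub2l.
  have -> : k = #|I :\ a| by have := cardsD1 a I; rewrite aI cI; lia.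
  apply: subset_leq_card; apply/subsetP => z; rewrite !inE => /andP[zI az].
  by rewrite zI andbT; apply: contraTneq az => ->; rewrite ltnn.
have cIa : #|I :\ a| = k by have := cardsD1 a I; rewrite aI cI; lia.
apply: leq_trans (IH _ cIa) _.
rewrite [leqRHS](eq_bigl (fun b => b \in I :\ a)); last first.
  by move=> b; rewrite !inE andbC.
apply: leq_sum => b; rewrite !inE => /andP[ba bI]; apply: leq_sub2l.
apply: subset_leq_card; apply/subsetP => z; rewrite !inE => /andP[zI az].
rewrite zI az !andbT; apply: contraTneq az => ->.
by rewrite -leqNgt amin.
Qed.

(** The weak counterpart: ties now only raise the counts. *)
Lemma sum_rank_le (T : finType) (x : T -> nat) (c k : nat) (I : {set T}) :
  #|I| = k ->
  (\sum_(a in I) (c - #|[set z in I | (z != a) && (x a <= x z)]|)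
     <= \sum_(i < k) (c - i))%N.
Proof.
elim: k I => [|k IH] I cI; first by rewrite (cards0_eq cI) big_set0.
have [a0 a0I] : exists a, a \in I by apply/card_gt0P; rewrite cI.
case: (@arg_minnP _ a0 (fun a => a \in I) x a0I) => a aI amin.
have cIa : #|I :\ a| = k by have := cardsD1 a I; rewrite aI cI; lia.
rewrite big_ord_recr /= (bigD1 a) //= addnC leq_add //; last first.
  apply: leq_sub2l; rewrite -cIa.
  apply: subset_leq_card; apply/subsetP => z; rewrite !inE => /andP[za zI].
  by rewrite zI za amin.
apply: leq_trans (IH _ cIa).
rewrite [leqRHS](eq_bigl (fun b => (b \in I) && (b != a))); last first.
  by move=> b; rewrite !inE andbC.
apply: leq_sum => b /andP[bI ba]; apply: leq_sub2l.
apply: subset_leq_card; apply/subsetP => z; rewrite !inE => /andP[/andP[za zI]].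
by move=> /andP[-> ->]; rewrite zI.
Qed.

Section Rank.
Variables (R : realFieldType) (T : finType) (M : nat).
Hypothesis M_gt0 : (0 < M)%N.
Local Notation conf := {ffun T -> 'I_M}.
Local Notation E := (@expect R T M).

(** By exchangeability the rank of [x] may be replaced by that of any member of [x |: A]. The sum
    over all members is deterministic up to ties. *)
Lemma expect_rank (x : T) (A : {set T}) (f : nat -> R) (r : rel nat) :
  x \notin A ->
  (#|A|.+1)%:R * E (fun w => f #|[set z in A | r (w x) (w z)]|) =
  E (fun w => \sum_(a in x |: A)
      f #|[set z in x |: A | (z != a) && r (w a) (w z)]|).
Proof.
move=> xA; rewrite expect_sum.
transitivity (\sum_(a in x |: A) E (fun w => f #|[set z in A | r (w x) (w z)]|)).
  by rewrite sumr_const cardsU1 xA -[RHS]mulr_natl.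
apply: eq_bigr => a aI.
rewrite -[RHS](@expect_swap R T M x a); apply: eq_expect => w.
rewrite -(card_preimset _ (@perm_inj _ (tperm x a))); congr (f #|(_ : {set T})|).
apply/setP => z; rewrite !inE !ffunE tpermR.
case: tpermP => [->|->|/eqP zx /eqP za].
- have [xa|xa] := eqVneq x a; first by rewrite -xa (negPf xA) eqxx.
  move: aI; rewrite !inE eq_sym (negPf xa) /= => ->.
  by rewrite eqxx.
- by rewrite (negPf xA) eqxx andbF.
- by rewrite (negPf zx) za.
Qed.

Lemma expect_eq_coord (x z : T) : z != x ->
  E (fun w => (w z == w x)%:R) = M%:R^-1.
Proof.
move=> zx; have xz : x != z by rewrite eq_sym.
rewrite -(expect_avg M_gt0 z).
rewrite -[RHS](expect_cst T M_gt0); apply: eq_expect => w.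
rewrite /avg (bigD1 (w x)) //= big1 ?addr0.
  by rewrite upd_at upd_neq // eqxx mul1r.
by move=> a ax; rewrite upd_at upd_neq // (negPf ax).
Qed.

Definition above (A : {set T}) (x : T) (w : conf) : nat :=
  #|[set z in A | (M <= w z + w x)%N]|.

(* Reflecting the value at x turns a threshold degree into a rank among
   exchangeable values, which is uniform up to ties. *)
Lemma expect_above (x : T) (A : {set T}) (f : nat -> R) : x \notin A ->
  E (fun w => f (above A x w)) = E (fun w => f #|[set z in A | (w x < w z)%N]|).
Proof.
move=> xA; rewrite -(expect_rev_at x); apply: eq_expect => w.
congr (f #|(_ : {set T})|); apply/setP => z; rewrite !inE.
have [zA|//] := boolP (z \in A).
rewrite /rev_at upd_at upd_neq /=; last by apply: contraNneq xA => <-.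
by have := ltn_ord (w x); have := ltn_ord (w z); lia.
Qed.

Lemma expect_above_ge (x : T) (A : {set T}) (c : nat) : x \notin A ->
  (\sum_(i < #|A|.+1) (c - i))%N%:R <=
  #|A|.+1%:R * E (fun w => (c - above A x w)%N%:R).
Proof.
move=> xA; rewrite (expect_above (fun m => (c - m)%N%:R) xA).
rewrite (expect_rank (fun m => (c - m)%N%:R) (fun i j => i < j)%N xA).
rewrite -[leLHS](expect_cst T M_gt0); apply: le_expect => w.
rewrite -natr_sum ler_nat.
apply: leq_trans (sum_rank_ge (fun z => w z) c (_ : #|x |: A| = _)) _.
  by rewrite cardsU1 xA.
apply: leq_sum => a _; apply: leq_sub2l; apply: subset_leq_card.
by apply/subsetP => z; rewrite !inE => /andP[-> /andP[]].
Qed.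

(** The strict and weak ranks of [x] differ by the number of ties with [x], whose mean is |A| /
    M. *)
Lemma expect_above_le (x : T) (A : {set T}) (c : nat) : x \notin A ->
  #|A|.+1%:R * E (fun w => (c - above A x w)%N%:R) <=
  (\sum_(i < #|A|.+1) (c - i))%N%:R + #|A|.+1%:R * (#|A|%:R / M%:R).
Proof.
move=> xA; rewrite (expect_above (fun m => (c - m)%N%:R) xA).
apply: (@le_trans _ _ (#|A|.+1%:R * E (fun w =>
   (c - #|[set z in A | (w x <= w z)%N]|)%:R + \sum_(z in A) (w z == w x)%:R))).
  rewrite ler_wpM2l ?ler0n //; apply: le_expect => w.
  rewrite -natr_sum -natrD ler_nat.
  have : (#|[set z in A | (w x <= w z)%N]| <=
         #|[set z in A | (w x < w z)%N]| + \sum_(z in A) (w z == w x))%N.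
    rewrite -!sum1_card -!big_mkcondr /= .
    rewrite (eq_bigl (fun z => (z \in A) && (w x <= w z)%N)); last by move=> z; rewrite inE.
    rewrite [X in (_ <= X + _)%N](eq_bigl (fun z => (z \in A) && (w x < w z)%N)); last by move=> z; rewrite inE.
    rewrite !big_mkcondr -big_split /=; apply: leq_sum => z _.
    by rewrite -val_eqE /=; case: ltngtP.
  lia.
rewrite expectD mulrDr lerD //.
  rewrite (expect_rank (fun m => (c - m)%N%:R) leq xA).
  rewrite -[leRHS](expect_cst T M_gt0); apply: le_expect => w.
  rewrite -natr_sum ler_nat.
  by apply: (@sum_rank_le _ (fun z => w z)); rewrite cardsU1 xA.
rewrite expect_sum ler_wpM2l ?ler0n // (eq_bigr (fun=> M%:R^-1)).
  by rewrite sumr_const -[leLHS]mulr_natl.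
by move=> z zA; rewrite expect_eq_coord //; apply: contraNneq xA => <-.
Qed.
End Rank.

(** * Gaps in a sample *)

Section Gap.
Variables (R : realFieldType) (T : finType) (M : nat).
Local Notation conf := {ffun T -> 'I_M}.
Local Notation E := (@expect R T M).

Definition count_ge (A : {set T}) (w : conf) (y : nat) : nat :=
  #|[set z in A | (y <= w z)%N]|.

(** Thresholds run from 0 to M, one more than the levels, hence ['I_M.+1]. A constant count means
    that no value of [A] lies in [y0, y0 + m). *)
Definition is_gap (A : {set T}) (j m : nat) (w : conf) (y0 : nat) : bool :=
  (y0 + m <= M)%N &&
  [forall y : 'I_M.+1, (y0 <= y <= y0 + m)%N ==> (count_ge A w y == j)].

Definition has_gap (A : {set T}) (j m : nat) (w : conf) : bool :=
  [exists y0 : 'I_M.+1, is_gap A j m w y0].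

Lemma is_gapP A j m w y0 : is_gap A j m w y0 ->
  forall y, (y0 <= y <= y0 + m)%N -> count_ge A w y = j.
Proof.
move=> /andP[ym /forallP h] y yy.
have yM : (y < M.+1)%N by lia.
by have := h (Ordinal yM); rewrite /= yy /= => /eqP.
Qed.

Definition top_set (A : {set T}) (j : nat) (w : conf) (J : {set T}) : bool :=
  [&& J \subset A, #|J| == j & [forall a in J, forall b in A :\: J, (w b <= w a)%N]].

Lemma exists_top_set (A : {set T}) j w : (j <= #|A|)%N -> exists J, top_set A j w J.
Proof.
elim: j => [|j IH] jA.
  exists set0; rewrite /top_set sub0set cards0 eqxx /=.
  by apply/forall_inP => a; rewrite inE.
have [J /and3P[JA /eqP cJ /forall_inP tJ]] := IH (ltnW jA).
have [b0 b0J] : exists b, b \in A :\: J.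
  by apply/card_gt0P; rewrite cardsD (setIidPr JA) cJ subn_gt0.
case: (@arg_maxnP _ b0 (fun b => b \in A :\: J) (fun b => w b) b0J) => b bJ bmax.
have [bnJ bA] := setDP bJ => {bnJ bA}.
move: (bJ); rewrite inE => /andP[bnJ bA].
exists (b |: J); rewrite /top_set subUset sub1set bA JA cardsU1 bnJ cJ eqxx /=.
apply/forall_inP => a; rewrite !inE => aJ; apply/forall_inP => c.
rewrite !inE negb_or -andbA => /and3P[cb cJ' cA].
have cAJ : c \in A :\: J by rewrite inE cJ'.
case/orP: aJ => [/eqP ->|aJ]; first exact: bmax.
by have /forall_inP := tJ _ aJ; apply.
Qed.

Definition top (A : {set T}) (j : nat) (w : conf) : {set T} :=
  odflt set0 [pick J | top_set A j w J].

Lemma topP (A : {set T}) j w : (j <= #|A|)%N -> top_set A j w (top A j w).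
Proof.
move=> jA; rewrite /top; case: pickP => [//|h].
by have [J] := exists_top_set w jA; rewrite h.
Qed.

(* Raising the j largest values by m maps the configurations with all values
   below M - m injectively into configurations in which no value falls in a
   window of length m between the j largest values and the others. *)
Definition shift_top (A : {set T}) (j m : nat) (w : conf) : conf :=
  [ffun z => if z \in top A j w then insubd (w z) (w z + m)%N else w z].

Definition low (A : {set T}) (m : nat) : {set conf} :=
  [set w : conf | [forall z in A, (w z + m < M)%N]].

Lemma shift_topE (A : {set T}) j m (w : conf) z : (j <= #|A|)%N -> w \in low A m ->
  shift_top A j m w z = (w z + (z \in top A j w) * m)%N :> nat.
Proof.
move=> jA; rewrite inE => /forall_inP lw; rewrite ffunE.
have [zJ|_] := boolP (z \in top A j w); last by rewrite mul0n addn0.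
rewrite val_insubd mul1n lw //.
by have /and3P[/subsetP JA _ _] := topP w jA; apply: JA.
Qed.

Lemma shift_top_gap (A : {set T}) j m (w : conf) :
  (m < M)%N -> (j <= #|A|)%N -> w \in low A m.+1 ->
  has_gap A j m (shift_top A j m.+1 w).
Proof.
move=> mM jA lw; have sE z := shift_topE z jA lw.
have /and3P[/subsetP JA /eqP cJ /forall_inP tJ] := topP w jA.
move: (lw); rewrite inE => /forall_inP lwA.
suff [y0 [y0M yJ yAJ]] : exists y0, [/\ (y0 + m <= M)%N,
    forall a, a \in top A j w -> (y0 <= (w a).+1)%N &
    forall b, b \in A :\: top A j w -> (w b < y0)%N].
  have y0M' : (y0 < M.+1)%N by lia.
  apply/existsP; exists (Ordinal y0M'); rewrite /is_gap /= y0M /=.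
  apply/forallP => y; apply/implyP => /andP[y1 y2].
  rewrite -[X in _ == X]cJ /count_ge; apply/eqP.
  apply: eq_card => z; rewrite !inE sE.
  have [zJ|zJ] := boolP (z \in top A j w).
    by rewrite JA //=; have := yJ _ zJ; lia.
  have [zA|//] := boolP (z \in A).
  by have := yAJ z; rewrite inE zJ zA => /(_ isT) /=; lia.
(* The window starts just above the largest value that is not raised. By ties a raised value may
   have started at y0 - 1, which is why the shift is by [m.+1]. *)
exists (\max_(b in A :\: top A j w) (w b).+1)%N; split.
- suff : (\max_(b in A :\: top A j w) (w b).+1 <= M - m)%N by lia.
  by apply/bigmax_leqP => b; rewrite inE => /andP[_ /lwA]; lia.
- by move=> a aJ; apply/bigmax_leqP => b bJ; have /forall_inP := tJ _ aJ; apply.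
- by move=> b bJ; apply: (@leq_bigmax_cond _ _ (fun b => (nat_of_ord (w b)).+1)).
Qed.

(** The image determines the top set. If a were raised only in w and b only in w', then w' b + m = w
    b <= w a = w' a - m <= w' b - m, which is impossible for m > 0. *)
Lemma shift_top_inj (A : {set T}) j m : (0 < m)%N -> (j <= #|A|)%N ->
  {in low A m &, injective (@shift_top A j m)}.
Proof.
move=> m0 jA.
have sub w w' : w \in low A m -> w' \in low A m ->
    shift_top A j m w = shift_top A j m w' -> top A j w \subset top A j w'.
  move=> lw lw' ww'.
  have /and3P[/subsetP JA /eqP cJ /forall_inP tJ] := topP w jA.
  have /and3P[/subsetP JA' /eqP cJ' /forall_inP tJ'] := topP w' jA.
  apply: contraT => /subsetPn[a aJ aJ'].
  have : ~~ (top A j w' \subset top A j w).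
    apply: contra aJ' => JJ.
    by have /eqP-> : top A j w' == top A j w by rewrite eqEcard JJ cJ cJ' leqnn.
  move=> /subsetPn[b bJ' bJ].
  have abw : (w b <= w a)%N.
    by have /forall_inP := tJ _ aJ; apply; rewrite inE bJ JA'.
  have abw' : (w' a <= w' b)%N.
    by have /forall_inP := tJ' _ bJ'; apply; rewrite inE aJ' JA.
  have ea := congr1 (fun f : conf => nat_of_ord (f a)) ww'.
  have eb := congr1 (fun f : conf => nat_of_ord (f b)) ww'.
  move: ea eb; rewrite /= !shift_topE // aJ bJ' (negPf aJ') (negPf bJ).
  rewrite !mul1n !mul0n !addn0.
  have arith (p q p' q' : nat) : (q <= p)%N -> (p' <= q')%N ->
    (p + m)%N = p' -> q = (q' + m)%N -> false by lia.
  exact: arith abw abw'.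
move=> w w' lw lw' ww'.
have JJ : top A j w = top A j w'.
  by apply/eqP; rewrite eqEsubset !sub.
apply/ffunP => z; apply: val_inj => /=.
have := congr1 (fun f : conf => nat_of_ord (f z)) ww'.
by rewrite /= !shift_topE // JJ => /addIn.
Qed.

(** By injectivity of the shift a gap is at least as likely as [low A m.+1], which fails with
    probability at most (m + 1) / M for each element of [A]. *)
Lemma expect_has_gap (A : {set T}) j m : (0 < M)%N -> (m < M)%N -> (j <= #|A|)%N ->
  1 - #|A|%:R * (m.+1%:R / M%:R) <= E (fun w => (has_gap A j m w)%:R).
Proof.
move=> M_gt0 mM jA.
have E1 : E (fun w => (w \in low A m.+1)%:R) <= E (fun w => (has_gap A j m w)%:R).
  rewrite /expect ler_wpM2r ?invr_ge0 ?ler0n // -!natr_sum ler_nat.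
  rewrite -!big_mkcond /= !sum1_card.
  rewrite -(card_in_imset (shift_top_inj (ltn0Sn m) jA)).
  apply: subset_leq_card; apply/subsetP => w /imsetP[w' lw' ->].
  exact: shift_top_gap.
apply: le_trans E1.
apply: (@le_trans _ _ (E (fun w => 1 - \sum_(z in A) (M <= w z + m.+1)%N%:R))).
  rewrite expectB expect_cst // expect_sum lerD2l lerN2.
  rewrite (eq_bigr (fun=> m.+1%:R / M%:R)); first by rewrite sumr_const -[leLHS]mulr_natl.
  move=> z _; rewrite (expect_coord M_gt0 z (fun a : 'I_M => (M <= a + m.+1)%N%:R)).
  congr (_ / _); rewrite -natr_sum; congr (_%:R).
  rewrite -big_mkcond /= -(big_mkord (fun i => (M <= i + m.+1)%N) (fun=> 1%N)).
  rewrite (@big_cat_nat _ _ _ (M - m.+1)) ?leq_subr //=.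
  rewrite [X in (X + _)%N]big_nat_cond big_pred0 ?add0n; last by move=> i; lia.
  rewrite big_nat_cond (eq_bigl (fun i => (M - m.+1 <= i < M)%N && true)); last by move=> i; lia.
  by rewrite -big_nat_cond sum_nat_const_nat muln1 subKn.
apply: le_expect => w; rewrite inE.
case: forall_inP => h; first by rewrite lerBlDr lerDl sumr_ge0.
have [z zA hz] : exists2 z, z \in A & (M <= w z + m.+1)%N.
  apply/exists_inP; apply: contra_notT h; rewrite negb_exists_in.
  by move=> /forall_inP h z zA; rewrite ltnNge h.
by rewrite (bigD1 z) //= hz subr_le0 lerDl sumr_ge0.
Qed.
End Gap.

(** * Flipping edges *)

Section Flip.
Variable T : finType.
Implicit Types h : rel T.

Definition flip h u v : rel T := fun x y =>
  if ((x == u) && (y == v)) || ((x == v) && (y == u)) then ~~ h x y else h x y.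

Lemma flip_simple h u v : u != v -> simple_graph h -> simple_graph (flip h u v).
Proof.
move=> uv [sh ih]; split=> [x y|x]; rewrite /flip.
  by rewrite orbC [(x == v) && _]andbC [(x == u) && _]andbC sh.
rewrite ih; case: ifP => // /orP[]/andP[/eqP-> /eqP xv];
  by rewrite xv eqxx in uv.
Qed.

Lemma flip_sub h g u v : symmetric g -> g u v -> subrel h g -> subrel (flip h u v) g.
Proof.
move=> sg guv hg x y; rewrite /flip; case: ifP => [|_ /hg //].
by case/orP => /andP[/eqP-> /eqP->] _ //; rewrite sg.
Qed.

Lemma flipC h u v : flip h u v =2 flip h v u.
Proof. by move=> x y; rewrite /flip orbC. Qed.

Lemma deg_flip h u v : u != v ->
  deg (flip h u v) u = if h u v then (deg h u).-1 else (deg h u).+1.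
Proof.
move=> uv; rewrite /deg.
have vu : (v == u) = false by rewrite eq_sym (negPf uv).
have [huv|huv] := boolP (h u v).
  rewrite [in RHS](cardsD1 v) inE huv /=; apply: eq_card => z.
  rewrite !inE /flip eqxx [u == v](negPf uv) /= orbF.
  by case: eqP => [->|//]; rewrite huv.
rewrite -(_ : #|v |: [set z | h u z]| = (#|[set z | h u z]|).+1); last first.
  by rewrite cardsU1 inE huv.
apply: eq_card => z; rewrite !inE /flip eqxx [u == v](negPf uv) /= orbF.
by case: eqP => [->|//]; rewrite huv.
Qed.

Lemma deg_flip_neq h u v w : w != u -> w != v -> deg (flip h u v) w = deg h w.
Proof.
by move=> wu wv; apply: eq_card => z; rewrite !inE /flip (negPf wu) (negPf wv).
Qed.

(* The degree counts are the second differences of the deficit. *)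
Definition deficit h (c : nat) : nat := \sum_v (c - deg h v).

(* A request (e, a, b) asks for an edge of g, present in h iff e, whose ends
   have degrees a and b in h. *)
Definition candidates (g h : rel T) (r : bool * nat * nat) : {set T * T} :=
  [set p | [&& g p.1 p.2, h p.1 p.2 == r.1.1, deg h p.1 == r.1.2 & deg h p.2 == r.2]].

(** Lowering a degree a raises (c - a)^+ exactly when a <= c, while increasing it lowers (c - a)^+
    exactly when a < c. *)
Definition flip_effect (c : nat) (r : bool * nat * nat) : int :=
  if r.1.1 then (r.1.2 <= c)%N%:Z + (r.2 <= c)%N%:Z
  else - ((r.1.2 < c)%N%:Z + (r.2 < c)%N%:Z).

Lemma deficit_flip h u v c : u != v -> symmetric h ->
  (deficit (flip h u v) c)%:Z =
  (deficit h c)%:Z + flip_effect c (h u v, deg h u, deg h v).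
Proof.
move=> uv sh; have vu : v != u by rewrite eq_sym.
rewrite /deficit (bigD1 u) //= (bigD1 v) //= [in RHS](bigD1 u) //=.
rewrite [in RHS](bigD1 v) //= (eq_bigr (fun w => c - deg h w)%N); last first.
  by move=> w /andP[wu wv]; rewrite deg_flip_neq.
set s := (\sum_(_ | _) _)%N.
have -> : deg (flip h u v) v = deg (flip h v u) v.
  by apply: eq_card => z; rewrite !inE flipC.
rewrite !deg_flip // [h v u]sh /flip_effect /=.
have [huv|huv] := boolP (h u v); last by lia.
have du : (0 < deg h u)%N by apply/card_gt0P; exists v; rewrite inE.
have dv : (0 < deg h v)%N by apply/card_gt0P; exists u; rewrite inE sh.
lia.
Qed.

Lemma card_incident (g : rel T) d (X : {set T}) :
  symmetric g -> regular_graph g d ->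
  (#|[set p : T * T | g p.1 p.2 && ((p.1 \in X) || (p.2 \in X))]| <= 2 * (#|X| * d))%N.
Proof.
move=> sg rg.
have cE (s : T * T -> T * T) : involutive s ->
    (forall p, g (s p).1 (s p).2 = g p.1 p.2) ->
    #|[set p : T * T | g p.1 p.2 && ((s p).1 \in X)]| = (#|X| * d)%N.
  move=> sK gs; rewrite -(card_imset _ (inv_inj sK)).
  transitivity (\sum_(p : T * T | g p.1 p.2 && (p.1 \in X)) 1)%N.
    rewrite sum1_card; apply: eq_card => p; rewrite -[p in LHS]sK mem_imset ?inE ?sK ?gs //.
    exact: inv_inj.
  rewrite (eq_bigl (fun p => (p.1 \in X) && g p.1 p.2)); last by move=> p; rewrite andbC.
  rewrite -(pair_big_dep (fun x => x \in X) (fun x y => g x y) (fun _ _ => 1%N)) /=.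
  rewrite (eq_bigr (fun=> d)) ?sum_nat_const // => x _.
  by rewrite sum1_card -(rg x) /deg; apply: eq_card => y; rewrite inE.
rewrite mul2n -addnn.
rewrite -[X in (_ <= X + _)%N](cE id) // -[X in (_ <= _ + X)%N](cE (fun p => (p.2, p.1))).
- rewrite -cardsUI; apply: leq_trans (leq_addr _ _).
  apply: subset_leq_card; apply/subsetP => p; rewrite !inE /=.
  by case/andP => -> /=.
- by case.
- by move=> p; rewrite sg.
Qed.

(** Greedy choice: the set X of ends used so far has at most two vertices per flip and meets at most
    2 |X| d ordered pairs, so some candidate avoids it. Off X, adjacency and degrees are still those
    of [h0], so this candidate still meets its request. *)
Lemma disjoint_flips (g h0 : rel T) d (reqs : seq (bool * nat * nat)) :
  simple_graph g -> regular_graph g d -> (0 < d)%N -> spanning_subgraph h0 g ->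
  (forall r, r \in reqs -> (4 * d * size reqs <= #|candidates g h0 r|)%N) ->
  exists2 h, spanning_subgraph h g &
    forall c, (deficit h c)%:Z = (deficit h0 c)%:Z + \sum_(r <- reqs) flip_effect c r.
Proof.
move=> [sg ig] rg d0 [sh0 h0g] big.
suff [h [X [[sh hg] _ _ _ hc]]] : exists h (X : {set T}),
    [/\ spanning_subgraph h g, (#|X| <= 2 * size reqs)%N,
      (forall u, u \notin X -> deg h u = deg h0 u),
      (forall u v, u \notin X -> h u v = h0 u v) &
      forall c, (deficit h c)%:Z =
        (deficit h0 c)%:Z + \sum_(r <- reqs) flip_effect c r].
  by exists h.
have : {subset reqs <= reqs} by [].
have : (size reqs <= size reqs)%N by [].
(* The induction shortens the list being served, while the supply of candidates stays measured
   against the full list. *)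
move: {1 3 5 6}reqs; elim=> [|r rs IH] szr sub.
  exists h0, set0; rewrite cards0; split=> // c.
  by rewrite big_nil addr0.
have [|x xr|h [X [[sh hg] cX dX hX hc]]] := IH; first exact: ltnW.
  by apply: sub; rewrite inE xr orbT.
have [[u v]] : exists p, p \in candidates g h0 r :\:
    [set p : T * T | g p.1 p.2 && ((p.1 \in X) || (p.2 \in X))].
  apply/card_gt0P; rewrite cardsD subn_gt0.
  apply: leq_ltn_trans (subset_leq_card (subsetIr _ _)) _.
  apply: leq_ltn_trans (card_incident X sg rg) _.
  apply: leq_trans (big r _); last by apply: sub; rewrite inE eqxx.
  move: szr => /= szr.
  have := leq_mul cX (leqnn d); have := leq_mul szr (leqnn d).
  nia.
rewrite !inE /= => /andP[nX /and4P[guv /eqP e1 /eqP e2 /eqP e3]].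
move: nX; rewrite guv /= negb_or => /andP[uX vX].
have uv : u != v by apply: contraTneq guv => ->; rewrite ig.
exists (flip h u v), (u |: (v |: X)); split.
- by split; [apply: flip_simple | apply: flip_sub].
- by rewrite /= !cardsU1; case: (_ \notin _); case: (_ \notin _); lia.
- move=> w; rewrite !inE !negb_or => /and3P[wu wv wX].
  by rewrite deg_flip_neq // dX.
- move=> w z; rewrite !inE !negb_or => /and3P[wu wv wX].
  by rewrite /flip (negPf wu) (negPf wv) /= hX.
move=> c; rewrite deficit_flip //; last by case: sh.
rewrite hX // !dX // e1 e2 e3 hc big_cons -!surjective_pairing.
by rewrite -addrA [flip_effect c r + _]addrC.
Qed.

End Flip.

(** * Special edges *)

Section Pairs.
Variables (T : finType) (g : rel T) (d : nat).
Hypotheses (sg : symmetric g) (ig : irreflexive g) (rg : regular_graph g d).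

Definition closed_nbhd (X : {set T}) : {set T} :=
  \bigcup_(z in X) (z |: [set w | g z w]).

Implicit Type X : {set T}.

Lemma mem_nbhd X z : z \in X -> z \in closed_nbhd X.
Proof. by move=> zX; apply/bigcupP; exists z; rewrite // !inE eqxx. Qed.

Lemma adj_nbhd X z w : z \in X -> g z w -> w \in closed_nbhd X.
Proof. by move=> zX zw; apply/bigcupP; exists z; rewrite // !inE zw orbT. Qed.

Lemma card_nbhd X : (#|closed_nbhd X| <= #|X| * d.+1)%N.
Proof.
rewrite -sum_nat_const /closed_nbhd.
elim/big_rec2: _ => [|z m Y zX IH]; first by rewrite cards0.
apply: leq_trans (leq_card_setU _ _) _; apply: leq_add => //.
by rewrite -[in leqRHS](rg z) /deg cardsU1 inE ig add1n ltnS.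
Qed.

(* Sp is the set of ends of edges whose closed neighbourhoods are pairwise
   disjoint, and rho maps both ends of such an edge to the same one of them. *)
Definition pair_system (Sp : {set T}) (rho : T -> T) : Prop :=
  [/\ forall z, z \in Sp -> #|[set w in Sp | g z w]| = 1%N,
      forall z z' w, z \in Sp -> z' \in Sp ->
        (w == z) || g w z -> (w == z') || g w z' -> rho z = rho z',
      forall z, z \in Sp -> rho z \in Sp &
      forall u, (#|[set z in Sp | rho z == u]| <= 2)%N].

Lemma exists_pair_system r : (0 < d)%N -> (2 * r * d.+1 ^ 3 < #|T|)%N ->
  exists Sp rho, pair_system Sp rho /\ #|Sp| = (2 * r)%N.
Proof.
move=> d0; elim: r => [|r IH] rT.
  exists set0, id; split; last by rewrite cards0.
  split=> [z|z z' w|z|u]; rewrite ?inE //.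
  by rewrite (_ : [set _ in _ | _] = set0) ?cards0 //; apply/setP => z; rewrite !inE.
have [|Sp [rho [[p1 p2 p3 p4] cS]]] := IH; first by apply: leq_ltn_trans rT; rewrite leq_mul2r; lia.
(* A vertex u at distance more than 3 from [Sp] has every neighbour v at distance more than 2, so
   the closed neighbourhoods of u and v avoid those of [Sp]. *)
have [u uS] : exists u, u \in ~: closed_nbhd (closed_nbhd (closed_nbhd Sp)).
  apply/card_gt0P; rewrite cardsCs setCK subn_gt0; apply: leq_ltn_trans (card_nbhd _) _.
  apply: leq_ltn_trans rT.
  have h1 := card_nbhd (closed_nbhd Sp); have h2 := card_nbhd Sp.
  rewrite !expnS expn0 muln1 !mulnA leq_mul //.
  apply: leq_trans h1 _; rewrite leq_mul //; apply: leq_trans h2 _.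
  by rewrite cS leq_mul2r; lia.
have [v guv] : exists v, g u v.
  have /card_gt0P[v] : (0 < deg g u)%N by rewrite rg.
  by rewrite inE; exists v.
rewrite inE in uS.
have vS : v \notin closed_nbhd (closed_nbhd Sp).
  by apply: contra uS => vS; apply: (adj_nbhd vS); rewrite sg.
have {}uS : u \notin closed_nbhd (closed_nbhd Sp).
  by apply: contra uS; apply: mem_nbhd.
have uv : u != v by apply: contraTneq guv => ->; rewrite ig.
have far z x : x \in Sp -> z \notin closed_nbhd (closed_nbhd Sp) ->
    [/\ z != x, ~~ g z x, ~~ g x z & forall w, (w == z) || g w z -> ~~ ((w == x) || g w x)].
  move=> xS zS; have H w : (w == z) || g w z -> ~~ ((w == x) || g w x).
    move=> wz; apply: contra zS => wx.
    have wS : w \in closed_nbhd Sp.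
      by case/orP: wx => [/eqP->|wx]; [apply: mem_nbhd | apply: (adj_nbhd xS); rewrite sg].
    by case/orP: wz => [/eqP<-|wz]; [apply: mem_nbhd | apply: (adj_nbhd wS)].
  have := H z; rewrite eqxx => /(_ isT); rewrite negb_or => /andP[h1 h2].
  by split=> //; rewrite sg.
exists (u |: (v |: Sp)), (fun z => if (z == u) || (z == v) then u else rho z).
have uSp : u \notin Sp by apply: contra uS => h; do 2!apply: mem_nbhd.
have vSp : v \notin Sp by apply: contra vS => h; do 2!apply: mem_nbhd.
have nuv z : z \in Sp -> (z == u) || (z == v) = false.
  by move=> zS; apply/negP => /orP[]/eqP zE; [rewrite -zE zS in uSp | rewrite -zE zS in vSp].
split; last by rewrite !cardsU1 !inE negb_or uv uSp vSp cS; lia.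
split.
- move=> z; rewrite !inE => /or3P[/eqP->|/eqP->|zS].
  + rewrite -(cards1 v); apply: eq_card => w; rewrite !inE.
    have [->|wu] := eqVneq w u; first by rewrite ig (negPf uv).
    have [->|wv] //= := eqVneq w v.
    by apply/negP => /andP[wS]; apply/negP; have [] := far u w wS uS.
  + rewrite -(cards1 u); apply: eq_card => w; rewrite !inE.
    have [->|wu] /= := eqVneq w u; first by rewrite sg guv.
    have [->|wv] /= := eqVneq w v; first by rewrite ig.
    by apply/negP => /andP[wS]; apply/negP; have [] := far v w wS vS.
  + rewrite -(p1 z zS); apply: eq_card => w; rewrite !inE.
    have [->|wu] /= := eqVneq w u.
      by have [_ _ /negPf-> _] := far u z zS uS; rewrite andbF.
    have [->|wv] //= := eqVneq w v.
    by have [_ _ /negPf-> _] := far v z zS vS; rewrite andbF.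
- have mix z z' w : (z == u) || (z == v) -> z' \in Sp ->
     (w == z) || g w z -> (w == z') || g w z' -> False.
    move=> /orP[]/eqP-> z'S wz wz'.
      by have [_ _ _ /(_ w wz)] := far u z' z'S uS; rewrite wz'.
    by have [_ _ _ /(_ w wz)] := far v z' z'S vS; rewrite wz'.
  move=> z z' w; rewrite !inE !orbA.
  have [zuv|_] := boolP ((z == u) || (z == v)); have [zuv'|_] //= := boolP ((z' == u) || (z' == v)).
  + by move=> _ z'S wz wz'; case: (mix z z' w).
  + by move=> zS _ wz wz'; case: (mix z' z w).
  + exact: p2.
- move=> z; rewrite !inE orbA; case: ifP => [_ _|_ zS]; first by rewrite eqxx.
  by rewrite p3 ?orbT.
move=> x; have [->|xu] := eqVneq x u.
  apply: leq_trans (_ : #|[set u; v]| <= 2)%N; last by rewrite cards2; case: (_ != _).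
  apply: subset_leq_card; apply/subsetP => z; rewrite !inE orbA.
  case: ifP => //= _ /andP[zS /eqP rz].
  by move: (p3 z zS); rewrite rz (negPf uSp).
apply: leq_trans (p4 x); apply: subset_leq_card; apply/subsetP => z; rewrite !inE orbA.
by case: ifP => //= _; rewrite [u == x]eq_sym (negPf xu).
Qed.
End Pairs.

(** * The threshold graph *)

Lemma triangular_sum k c : (c <= k)%N -> (2 * \sum_(i < k) (c - i) = c * c.+1)%N.
Proof.
elim: k c => [|k IH] c ck; first by rewrite big_ord0; lia.
case: c ck => [|c] ck.
  by rewrite big1 // => i _; rewrite sub0n.
rewrite big_ord_recl /= mulnDr; under eq_bigr do rewrite /bump add1n subSS.
rewrite IH //; lia.
Qed.

Section Averages.
Variables (R : realFieldType) (d : nat).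
Hypothesis d_gt1 : (1 < d)%N.

(* A special neighbour lowers the expected deficit of a vertex by at most
   excess c (up to ties), while being special raises it by d * excess c; as the d - 1 outer neighbours
   of each special vertex are the only ones that lose, every special vertex
   brings a net gain of at least excess c. *)
Definition excess (c : nat) : R := c%:R * (d%:R - c%:R) / (2 * d%:R * d.+1%:R).
Definition mean_deficit (c : nat) : R := c%:R * c.+1%:R / (2 * d.+1%:R).

(* Expected deficit, up to ties, of an ordinary vertex with t special
   neighbours: these are all joined to it or all not, with probability 1/2. *)
Definition ordinary_deficit (t c : nat) : R :=
  (\sum_(i < (d - t).+1) (c - i) + \sum_(i < (d - t).+1) (c - t - i))%N%:R /
  (2 * (d - t).+1%:R).

(** The lower bound is an equality for t = 0, for t = 1 and for c = d. Only t = 2 with c < d leaves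
    a remainder, which is nonnegative and at most 2 / d. *)
Lemma pred_deficit_bounds t c : (t <= 2)%N -> (0 < c <= d)%N ->
  mean_deficit c - t%:R * excess c <= ordinary_deficit t c
    <= mean_deficit c - t%:R * excess c + (c < d)%N%:R * (t%:R / d%:R).
Proof.
move=> t2 /andP[c0 cd].
have d0 : 0 < d%:R :> R by rewrite ltr0n; lia.
have d1 : 0 < d.+1%:R :> R by rewrite ltr0n; lia.
have nz : d%:R != 0 :> R by rewrite gt_eqF.
have nz1 : 1 + d%:R != 0 :> R by rewrite addrC natr1 gt_eqF.
have nat2 a b : (2 * a = b)%N -> a%:R = b%:R / 2 :> R.
  by move=> <-; rewrite natrM mulrC mulKf ?pnatr_eq0.
rewrite /ordinary_deficit /mean_deficit /excess natrD.
case: t t2 => [|[|[|//]]] _.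
- rewrite subn0 subn0 (nat2 _ _ (triangular_sum (leqW cd))) mul0r subr0 mul0r mulr0 addr0.
  have -> : ((c * c.+1)%:R / 2 + (c * c.+1)%:R / 2) / (2 * d.+1%:R) = c%:R * c.+1%:R / (2 * d.+1%:R) :> R.
    by rewrite natrM; field; rewrite nz1.
  by rewrite lexx.
- have dE : ((d - 1).+1 = d)%N by lia.
  rewrite dE (nat2 _ _ (triangular_sum cd)) (nat2 _ _ (triangular_sum (_ : c - 1 <= d)%N)); last lia.
  have -> : (c - 1).+1 = c by lia.
  rewrite !natrM natrB // mul1r.
  set X := (X in X <= _ <= _); set Y := (Y in _ <= Y <= _).
  have XY : X = Y.
    by rewrite /X /Y -!natr1; field; rewrite nz addrC nz1.
  rewrite -/X XY lexx lerDl mulr_ge0 ?ler0n // mulr_ge0 ?invr_ge0 ?ler0n //.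
have dE : ((d - 2).+1 = d - 1)%N by lia.
have t1 : (2 * \sum_(i < (d - 2).+1) (c - 2 - i) = (c - 1) * (c - 2))%N.
  rewrite triangular_sum; last by lia.
  by case: c c0 {cd} => [|[|c]] // _; rewrite /= !subSS !subn0; lia.
rewrite (nat2 _ _ t1) dE.
have d1' : 0 < d%:R - 1 :> R by rewrite subr_gt0 ltr1n.
have [cd'|cd'] := ltnP c d.
  rewrite (nat2 _ _ (triangular_sum (_ : c <= d - 1)%N)); last lia.
  have -> : ((c - 1) * (c - 2))%N%:R = (c%:R - 1) * (c%:R - 2) :> R.
    by case: c c0 {cd cd' t1} => [|[|c]] // _; rewrite /= natrM ?subrr ?mul0r // !natrB //.
  rewrite !natrM natrB ?(ltnW d_gt1) // mulr1n ?mul1r -[c.+1%:R]natr1 -[d.+1%:R]natr1.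
  have y2 : 2 <= d%:R :> R by rewrite ler_nat.
  have xy : c%:R + 1 <= d%:R :> R by rewrite natr1 ler_nat.
  have x1 : 1 <= c%:R :> R by rewrite ler1n.
  move: (c%:R) (d%:R) d0 d1' y2 xy x1 => x y d0 d1' y2 xy x1 {d1}.
  have -> : (x * (x + 1) / 2 + (x - 1) * (x - 2) / 2) / (2 * (y - 1)) =
    x * (x + 1) / (2 * (y + 1)) - 2 * (x * (y - x) / (2 * y * (y + 1))) +
    (y ^+ 2 - y * (2 * x - 1) + 2 * x ^+ 2) / (2 * y * (y ^+ 2 - 1)).
    by field; rewrite !lt0r_neq0 //=; nra.
  have D0 : 0 < 2 * y * (y ^+ 2 - 1) by nra.
  (* The numerator of the remainder is (y - x)^2 + x^2 + y. *)
  apply/andP; split; first by rewrite lerDl divr_ge0 ?(ltW D0) //; nra.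
  rewrite lerD2l ?mul1r ler_pdivrMr //.
  have -> : 2 / y * (2 * y * (y ^+ 2 - 1)) = 4 * (y ^+ 2 - 1) by field; rewrite gt_eqF.
  by nra.
have {cd'} -> : c = d by lia.
have t2 : (2 * \sum_(i < d - 1) (d - i) = d * d.+1 - 2)%N.
  have := triangular_sum (leqnn d).
  have [d' dE'] : exists d', d = d'.+1 by exists d.-1; lia.
  by rewrite dE' subn1 /= big_ord_recr /= mulnDr; lia.
rewrite (nat2 _ _ t2) natrB ?natrM ?natrB ?(ltnW d_gt1) //; last by nia.
rewrite subrr !mulr0 !mul0r mulr0 subr0 addr0 mulr1n -[d.+1%:R]natr1.
have -> : (d%:R * (d%:R + 1) - 2) / 2 + (d%:R - 1) * (d%:R - 2) / 2 = d%:R * (d%:R - 1) :> R by field.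
have -> : d%:R * (d%:R - 1) / (2 * (d%:R - 1)) = d%:R * (d%:R + 1) / (2 * (d%:R + 1)) :> R.
  by field; rewrite addrC nz1 gt_eqF.
by rewrite lexx.
Qed.
End Averages.

Section Model.
Variables (R : realFieldType) (T : finType) (M : nat) (g : rel T) (d : nat).
Variables (Sp : {set T}) (rho : T -> T).
Hypotheses (M_gt0 : (0 < M)%N) (M_even : ~~ odd M).
Hypotheses (sg : symmetric g) (ig : irreflexive g) (rg : regular_graph g d).
Hypothesis pS : pair_system g Sp rho.
Local Notation conf := {ffun T -> 'I_M}.
Local Notation E := (@expect R T M).

(* Both ends of a special edge get the same extreme level, 0 or M. *)
Definition level (w : conf) (z : T) : nat :=
  if z \in Sp then (if (2 * w (rho z) < M)%N then 0 else M)%N else w z.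

Definition threshold_graph (w : conf) : rel T := fun u v => g u v && (M <= level w u + level w v)%N.

Lemma thr_spanning w : spanning_subgraph (threshold_graph w) g.
Proof.
split; last by move=> u v /andP[].
by split=> [u v|u]; rewrite /threshold_graph ?ig // sg addnC.
Qed.

Definition special_degree (w : T) : nat := #|[set z in Sp | g w z]|.

(** The only special neighbour shares the coin of [z], so the degree of [z] is 0 or d, each with
    probability 1/2. *)
Lemma expect_deficit_special z c : z \in Sp -> (c <= d)%N ->
  E (fun w => (c - deg (threshold_graph w) z)%N%:R) = c%:R / 2.
Proof.
move=> zS cd; have [p1 p2 p3 p4] := pS.
rewrite (eq_expect (f' := fun w => (fun (b : bool) (_ : conf) => if b then c%:R else 0)
   (2 * w (rho z) < M)%N w)).
  by rewrite (@expect_coin R T M M_gt0 (rho z) (fun b _ => if b then c%:R else 0) M_even) // !expect_cst // addr0.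
move=> w /=; case: ifP => wz.
  rewrite (_ : deg _ _ = 0%N) ?subn0 //; apply: eq_card0 => x; rewrite !inE /threshold_graph.
  apply/negP => /andP[gzx]; rewrite /level zS wz add0n.
  case: ifP => [xS|_]; last by rewrite leqNgt ltn_ord.
  by rewrite -(p2 z x z) ?eqxx ?gzx ?orbT // wz leqNgt M_gt0.
rewrite (_ : deg _ _ = d); first by rewrite (eqP cd).
rewrite -(rg z); apply: eq_card => x; rewrite !inE /threshold_graph.
by rewrite /level zS wz leq_addr andbT.
Qed.

Lemma deg_thr w z u : z \notin Sp -> (forall x, x \in Sp -> g z x -> rho x = u) ->
  deg (threshold_graph w) z = (above [set x in ~: Sp | g z x] z w +
                  (if (2 * w u < M)%N then 0 else special_degree z))%N.
Proof.
move=> zS zu.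
transitivity (above [set x in ~: Sp | g z x] z w +
    #|[set x in Sp | g z x && ~~ (2 * w u < M)%N]|)%N.
  rewrite /deg /above -[RHS]cardsUI (_ : _ :&: _ = set0) ?cards0 ?addn0; last first.
    by apply/setP => x; rewrite !inE; case: (_ \in Sp); rewrite ?andbF.
  apply: eq_card => x; rewrite !inE /threshold_graph /level (negPf zS).
  have [xS|xS] /= := boolP (x \in Sp); last by rewrite orbF addnC.
  case: (boolP (g z x)) => //= gzx; rewrite (zu x) //.
  by case: (_ < M)%N; rewrite /= ?addn0 ?leq_addl // leqNgt ltn_ord.
congr (_ + _)%N; case: (_ < M)%N; rewrite /special_degree.
  by apply: eq_card0 => x; rewrite !inE !andbF.
by apply: eq_card => x; rewrite !inE andbT.
Qed.

Lemma nb_special_le2 z : (special_degree z <= 2)%N.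
Proof.
have [p1 p2 p3 p4] := pS; rewrite /special_degree.
have [->|[x]] := set_0Vmem [set x in Sp | g z x]; first by rewrite cards0.
rewrite inE => /andP[xS gzx]; apply: leq_trans (p4 (rho x)).
apply: subset_leq_card; apply/subsetP => y; rewrite !inE => /andP[yS gzy].
by rewrite yS (p2 y x z) ?gzx ?gzy ?orbT ?eqxx.
Qed.

(** All special neighbours of [z] belong to one pair and obey one coin. Its coordinate is that of a
    special vertex, hence outside [A], so the coin does not affect the links to ordinary
    neighbours. *)
Lemma expect_deficit_split z c : z \notin Sp ->
  exists2 A : {set T}, z \notin A /\ (#|A| + special_degree z = d)%N &
  E (fun w => (c - deg (threshold_graph w) z)%N%:R) =
   (E (fun w => (c - above A z w)%N%:R) +
    E (fun w => (c - special_degree z - above A z w)%N%:R)) / 2.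
Proof.
move=> zS; have [p1 p2 p3 p4] := pS.
set A := [set x in ~: Sp | g z x]; exists A.
  split; first by rewrite !inE ig andbF.
  rewrite -(rg z) /special_degree -cardsUI (_ : _ :&: _ = set0) ?cards0 ?addn0; last first.
    by apply/setP => x; rewrite !inE; case: (_ \in Sp); rewrite ?andbF.
  by apply: eq_card => x; rewrite !inE; case: (_ \in Sp); rewrite ?orbF.
have degE u : (forall x, x \in Sp -> g z x -> rho x = u) ->
    E (fun w => (c - deg (threshold_graph w) z)%N%:R) = E (fun w => (fun b w =>
      (c - (above A z w + (if b then 0 else special_degree z)))%N%:R) (2 * w u < M)%N w).
  by move=> zu; apply: eq_expect => w; rewrite (deg_thr _ zS zu).
(* Without special neighbours the coin is a dummy, read at [z], and both summands coincide. *)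
have [e0|[x]] := set_0Vmem [set x in Sp | g z x].
  have t0 : special_degree z = 0%N by rewrite /special_degree e0 cards0.
  have zu x : x \in Sp -> g z x -> rho x = z.
    move=> xS gzx; have : x \in set0 by rewrite -e0 inE xS.
    by rewrite inE.
  rewrite (degE z zu) {zu}; rewrite t0 subn0.
  rewrite -mulr2n -[_ *+ 2]mulr_natr mulfK ?pnatr_eq0 //.
  by apply: eq_expect => w; case: ifP; rewrite addn0.
rewrite inE => /andP[xS gzx].
have uz : z != rho x by apply: contraNneq zS => ->; apply: p3.
have uA : rho x \notin A by rewrite !inE negb_and negbK p3.
rewrite (degE (rho x)) => [|y yS gzy]; last first.
  by rewrite (p2 y x z) ?gzx ?gzy ?orbT ?eqxx.
have aE w : above A z (rev_at (rho x) w) = above A z w.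
  apply: eq_card => y; rewrite !inE.
  case yE: (y \notin Sp); rewrite //= /rev_at !upd_neq //.
  by apply: contraTneq yE => ->; rewrite negbK p3.
rewrite (@expect_coin R T M M_gt0 (rho x) (fun b w =>
    (c - (above A z w + (if b then 0 else special_degree z)))%N%:R) M_even) => [|b w];
  last by rewrite aE.
congr ((_ + _) / _); apply: eq_expect => w; rewrite ?addn0 //.
by rewrite addnC subnDA.
Qed.

Lemma expect_deficit_ordinary z c : z \notin Sp ->
  ordinary_deficit R d (special_degree z) c <= E (fun w => (c - deg (threshold_graph w) z)%N%:R)
    <= ordinary_deficit R d (special_degree z) c + d%:R / M%:R.
Proof.
move=> zS; have [A [zA cA] ->] := expect_deficit_split c zS.
have cA' : #|A| = (d - special_degree z)%N by rewrite -cA addnK.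
have l1 := expect_above_ge R M_gt0 c zA.
have l2 := expect_above_ge R M_gt0 (c - special_degree z) zA.
have u1 := expect_above_le R M_gt0 c zA.
have u2 := expect_above_le R M_gt0 (c - special_degree z) zA.
rewrite /ordinary_deficit -cA'.
have k0 : 0 < #|A|.+1%:R :> R by rewrite ltr0n.
have Ad : #|A|%:R / M%:R <= d%:R / M%:R :> R.
  by rewrite ler_wpM2r ?invr_ge0 ?ler0n // ler_nat -cA leq_addr.
set k := #|A|.+1%:R in l1 l2 u1 u2 k0 *.
set e1 := E _ in l1 u1 *; set e2 := E _ in l2 u2 *.
rewrite natrD; set s1 := _%:R in l1 u1 *; set s2 := (\sum_(_ < _) _)%N%:R in l2 u2 *.
set q := #|A|%:R / M%:R in u1 u2 Ad *.
apply/andP; split.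
  rewrite ler_pdivrMr ?mulr_gt0 //; lra.
apply: le_trans (_ : _ <= (s1 + s2) / (2 * k) + q) _; last by rewrite lerD2l.
rewrite -lerBlDr ler_pdivlMr ?mulr_gt0 //; lra.
Qed.

End Model.

(** * Influence of a single coordinate on deficits and candidates *)

Section Locality.
Variables (T : finType) (g : rel T) (d : nat).
Hypotheses (sg : symmetric g) (ig : irreflexive g) (rg : regular_graph g d).
Implicit Types (h : rel T) (Z : {set T}).

Lemma card_pairs (P : rel T) :
  (\sum_v #|[set x | P v x]| = #|[set p : T * T | P p.1 p.2]|)%N.
Proof.
rewrite -[RHS]sum1_card (eq_bigl (fun p => true && P p.1 p.2)); last by move=> p; rewrite inE.
rewrite -(pair_big_dep xpredT (fun v x => P v x) (fun _ _ => 1%N)) /=.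
by apply: eq_bigr => v _; rewrite sum1_card; apply: eq_card => x; rewrite inE.
Qed.

Lemma deficit_local h h' Z c : subrel h' g ->
  (forall u v, u \notin Z -> v \notin Z -> h u v = h' u v) ->
  (deficit h c <= deficit h' c + 2 * (#|Z| * d))%N.
Proof.
move=> h'g hh'; apply: leq_trans (leq_add (leqnn _) (card_incident Z sg rg)).
rewrite -(card_pairs (fun x y => g x y && ((x \in Z) || (y \in Z)))).
rewrite /deficit -big_split /=; apply: leq_sum => v _.
suff : (deg h' v <= deg h v + #|[set x | g v x && ((v \in Z) || (x \in Z))]|)%N by lia.
rewrite /deg -cardsUI; apply: leq_trans (leq_addr _ _).
apply: subset_leq_card; apply/subsetP => x; rewrite !inE => hvx.
rewrite (h'g _ _ hvx) /=.
have [//|vZ] := boolP (v \in Z); rewrite ?orbT //.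
have [//|xZ] := boolP (x \in Z); rewrite ?orbT //.
by rewrite hh' // hvx.
Qed.

(** Changes at pairs meeting [Z] alter degrees only inside the closed neighbourhood of [Z], so every
    candidate that is lost meets this neighbourhood. *)
Lemma cand_local h h' Z r : subrel h g -> subrel h' g ->
  (forall u v, u \notin Z -> v \notin Z -> h u v = h' u v) ->
  (#|candidates g h r| <= #|candidates g h' r| + 2 * (#|closed_nbhd g Z| * d))%N.
Proof.
move=> hg h'g hh'.
apply: leq_trans (leq_add (leqnn _) (card_incident (closed_nbhd g Z) sg rg)).
rewrite -cardsUI; apply: leq_trans (leq_addr _ _).
have nZ u v : u \notin closed_nbhd g Z -> h u v = h' u v.
  move=> uZ; have uZ' : u \notin Z by apply: contra uZ; apply: mem_nbhd.
  have [vZ|vZ] := boolP (v \in Z); last exact: hh'.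
  have guv : ~~ g u v by apply: contra uZ => guv; apply: (adj_nbhd vZ); rewrite sg.
  by apply/idP/idP => [/hg|/h'g]; rewrite (negPf guv).
have dZ u : u \notin closed_nbhd g Z -> deg h u = deg h' u.
  by move=> uZ; apply: eq_card => v; rewrite !inE nZ.
apply: subset_leq_card; apply/subsetP => -[u v]; rewrite !inE /= => /and4P[guv e1 e2 e3].
rewrite guv /=.
have [//|uZ] := boolP (u \in closed_nbhd g Z); rewrite ?orbT //.
have [//|vZ] := boolP (v \in closed_nbhd g Z); rewrite ?orbT //.
by rewrite -nZ // -!dZ // e1 e2 e3.
Qed.
End Locality.

Section Model.
Variables (R : realFieldType) (T : finType) (M : nat) (g : rel T) (d : nat).
Variables (Sp : {set T}) (rho : T -> T).
Hypotheses (sg : symmetric g) (ig : irreflexive g) (rg : regular_graph g d).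
Hypothesis pS : pair_system g Sp rho.
Local Notation conf := {ffun T -> 'I_M}.
Local Notation E := (@expect R T M).
Local Notation threshold_graph := (@threshold_graph T M g Sp rho).
Local Notation level := (@level T M Sp rho).

Lemma sum_nb_special : (\sum_(z | z \notin Sp) special_degree g Sp z = #|Sp| * d.-1)%N.
Proof.
have [p1 p2 p3 p4] := pS.
under eq_bigr => z _.
  rewrite /special_degree -sum1_card (eq_bigl (fun x => (x \in Sp) && g z x)); last by move=> x; rewrite inE.
  over.
rewrite (exchange_big_dep (fun x => x \in Sp)) /=; last by move=> z x _ /andP[].
rewrite -sum_nat_const; apply: eq_bigr => x xS.
rewrite (eq_bigl (fun z => (z \notin Sp) && g x z)); last by move=> z; rewrite xS sg.
rewrite -(rg x) sum1dep_card /deg -[in RHS](cardsID Sp) -[X in (_ = (X + _).-1)%N](_ : 1 = _)%N.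
  by apply: eq_card => z; rewrite !inE.
by rewrite -(p1 x xS); apply: eq_card => z; rewrite !inE andbC.
Qed.

(** A coordinate governs its own vertex and, through [rho], at most the two ends of one special
    edge. *)
Lemma card_level_neq z (w w' : conf) : (forall y, y != z -> w y = w' y) ->
  (#|[set x | level w x != level w' x]| <= 3)%N.
Proof.
move=> ww'; have [p1 p2 p3 p4] := pS.
apply: leq_trans (_ : #|z |: [set x in Sp | rho x == z]| <= _)%N; last first.
  by rewrite cardsU1; have := p4 z; case: (_ \notin _) => /=; lia.
apply: subset_leq_card; apply/subsetP => x; rewrite !inE /level.
case: ifP => xS; last by apply: contraR; rewrite orbF => xz; rewrite ww'.
by apply: contraR; rewrite negb_or => /andP[_ xz]; rewrite ww'.
Qed.

Lemma thr_local w w' u v : u \notin [set x | level w x != level w' x] ->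
  v \notin [set x | level w x != level w' x] -> threshold_graph w u v = threshold_graph w' u v.
Proof. by rewrite !inE !negbK /threshold_graph => /eqP-> /eqP->. Qed.

Lemma norm_natB_le (a b k : nat) : (a <= b + k)%N -> (b <= a + k)%N ->
  `|a%:R - b%:R| <= k%:R :> R.
Proof.
move=> ab ba; have ab' : a%:R <= b%:R + k%:R :> R by rewrite -natrD ler_nat.
have ba' : b%:R <= a%:R + k%:R :> R by rewrite -natrD ler_nat.
by rewrite ler_norml; apply/andP; split; lra.
Qed.

Lemma bounded_diff_deficit c :
  bounded_diff (6 * d)%N%:R (fun w => (deficit (threshold_graph w) c)%:R : R).
Proof.
move=> z w w' ww'.
have sub v : subrel (threshold_graph v) g by have [] := thr_spanning Sp rho sg ig v.
have c3 := card_level_neq ww'; set Z := [set x | _] in c3.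
have c3' : (2 * (#|Z| * d) <= 6 * d)%N by rewrite mulnA leq_mul2r; lia.
apply: norm_natB_le.
  apply: leq_trans (deficit_local sg rg c (sub w') (@thr_local w w')) _.
  by rewrite leq_add2l.
apply: leq_trans (deficit_local sg rg (Z := Z) c (sub w) _) _.
  by move=> u v uZ vZ; rewrite (thr_local uZ vZ).
by rewrite leq_add2l.
Qed.

Hypothesis d_gt1 : (1 < d)%N.

Lemma bounded_diff_cand r :
  bounded_diff (9 * d ^ 2)%N%:R (fun w => #|candidates g (threshold_graph w) r|%:R : R).
Proof.
move=> z w w' ww'.
have sub v : subrel (threshold_graph v) g by have [] := thr_spanning Sp rho sg ig v.
have c3 := card_level_neq ww'; set Z := [set x | _] in c3.
(* The bound 6 d (d + 1) is at most 9 d^2 because d >= 2. *)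
have c3' : (2 * (#|closed_nbhd g Z| * d) <= 9 * d ^ 2)%N.
  have h1 : (#|closed_nbhd g Z| <= 3 * d.+1)%N.
    by apply: leq_trans (card_nbhd ig rg Z) _; rewrite leq_mul.
  have := leq_mul h1 (leqnn d); nia.
apply: norm_natB_le.
  apply: leq_trans (cand_local sg rg r (sub w) (sub w') (@thr_local w w')) _.
  by rewrite leq_add2l.
apply: leq_trans (cand_local sg rg (Z := Z) r (sub w') (sub w) _) _.
  by move=> u v uZ vZ; rewrite (thr_local uZ vZ).
by rewrite leq_add2l.
Qed.
Hypotheses (M_gt0 : (0 < M)%N) (M_even : ~~ odd M).

Lemma expect_deficit_bounds r c : #|Sp| = (2 * r)%N -> (0 < c <= d)%N ->
  let m := #|T|%:R * mean_deficit R d c + 2 * r%:R * excess R d c in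
  m <= E (fun w => (deficit (threshold_graph w) c)%:R)
    <= m + (c < d)%N%:R * (2 * r%:R) + #|T|%:R * (d%:R / M%:R).
Proof.
move=> cS cd; set m := _ + _; cbn zeta.
have [c0 cd'] := andP cd.
have d0 : 0 < d%:R :> R by rewrite ltr0n; lia.
pose t z : R := (special_degree g Sp z)%:R.
pose l z := mean_deficit R d c + (if z \in Sp then d%:R * excess R d c else - (t z * excess R d c)).
pose s z := (if z \in Sp then 0 else (c < d)%N%:R * (t z / d%:R)) + d%:R / M%:R.
have b z : l z <= E (fun w => (c - deg (threshold_graph w) z)%N%:R) <= l z + s z.
  have dM : 0 <= d%:R / M%:R :> R by rewrite divr_ge0.
  rewrite /l /s; case: ifP => zS.
    rewrite (expect_deficit_special R M_gt0 M_even rg pS zS cd').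
    have -> : mean_deficit R d c + d%:R * excess R d c = c%:R / 2.
      rewrite /mean_deficit /excess -[c.+1%:R]natr1 -[d.+1%:R]natr1; field.
      by rewrite !gt_eqF // addr_gt0.
    by rewrite lexx add0r lerDl.
  have /andP[l1 l2] := expect_deficit_ordinary R M_gt0 M_even ig rg pS c (negbT zS).
  have /andP[l3 l4] := pred_deficit_bounds R d_gt1 (nb_special_le2 pS z) cd.
  rewrite (le_trans l3 l1) /=; apply: le_trans l2 _.
  by rewrite addrA lerD2r.
rewrite (eq_expect (f' := fun w => \sum_z (c - deg (threshold_graph w) z)%N%:R)); last first.
  by move=> w; rewrite /deficit natr_sum.
rewrite expect_sum.
have st : \sum_(z | z \notin Sp) t z = 2 * r%:R * (d%:R - 1).
  rewrite /t -natr_sum sum_nb_special cS !natrM -subn1 natrB //; lia.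
have sl : \sum_z l z = m.
  rewrite big_split /= sumr_const -[_ *+ #|_|]mulr_natl; congr (_ + _).
  rewrite (bigID (fun z => z \in Sp)) /=.
  rewrite (eq_bigr (fun=> d%:R * excess R d c)); last by move=> z ->.
  rewrite sumr_const -[_ *+ #|_|]mulr_natl cS.
  rewrite (eq_bigr (fun z => - (t z * excess R d c))); last by move=> z /negPf->.
  by rewrite sumrN -mulr_suml st natrM; ring.
have ss : \sum_z s z <= (c < d)%N%:R * (2 * r%:R) + #|T|%:R * (d%:R / M%:R).
  rewrite big_split /= sumr_const -[_ *+ #|_|]mulr_natl lerD2r.
  rewrite (bigID (fun z => z \in Sp)) /= big1 ?add0r; last by move=> z ->.
  rewrite (eq_bigr (fun z => (c < d)%N%:R * (t z / d%:R))); last by move=> z /negPf->.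
  rewrite -mulr_sumr -mulr_suml st ler_wpM2l ?ler0n //.
  rewrite ler_pdivrMr // ler_wpM2l ?mulr_ge0 ?ler0n //; lra.
rewrite -sl; apply/andP; split; first by apply: ler_sum => z _; case/andP: (b z).
rewrite -addrA; apply: le_trans (_ : \sum_z (l z + s z) <= _).
  by apply: ler_sum => z _; case/andP: (b z).
by rewrite big_split lerD2l.
Qed.

End Model.

(** * Edges with prescribed end degrees *)

Section TwoCoords.
Variables (R : realFieldType) (T : finType) (M : nat).
Local Notation conf := {ffun T -> 'I_M}.
Local Notation E := (@expect R T M).

Lemma count_interval s l : (s + l <= M)%N ->
  (\sum_(a < M) (s <= a < s + l) = l)%N.
Proof.
move=> slM; rewrite -big_mkcond -(big_mkord (fun i => s <= i < s + l)%N (fun=> 1%N)) /=.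
rewrite -[RHS](addKn s l) -[RHS]muln1 -sum_nat_const_nat.
by rewrite (big_nat_widenl _ _ _ _ _ (leq0n s)) (big_nat_widen _ _ _ _ _ slM).
Qed.

(** [X] is read before and [f] after the values at [u] and [v] are redrawn; a box of l^2 favourable
    pairs has probability (l / M)^2. *)
Lemma expect_two_coords (f X : pred conf) (u v : T) (l : nat) : (0 < M)%N ->
  (forall w, X w -> exists s t : nat, [/\ (s + l <= M)%N, (t + l <= M)%N &
    forall a b : 'I_M, (s <= a < s + l)%N -> (t <= b < t + l)%N ->
      f (upd (upd w u a) v b)]) ->
  (l%:R / M%:R) ^+ 2 * E (fun w => (X w)%:R) <= E (fun w => (f w)%:R).
Proof.
move=> M_gt0 hX; rewrite -[leRHS](expect_avg M_gt0 v) -[leRHS](expect_avg M_gt0 u) -expectZ.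
apply: le_expect => w.
have M0 : 0 < M%:R :> R by rewrite ltr0n.
have [/hX [s [t [sl tl fab]]]|_] := boolP (X w); last first.
  rewrite mulr0; apply: avg_ge => // a; apply: avg_ge => // b; exact: ler0n.
have inner (a : 'I_M) : (s <= a < s + l)%N%:R * (l%:R / M%:R) <=
    avg v (fun w => (f w)%:R) (upd w u a) :> R.
  have [ha|_] := boolP (s <= a < s + l)%N; last first.
    by rewrite mul0r; apply: avg_ge => // b; apply: ler0n.
  rewrite mul1r ler_wpM2r ?invr_ge0 ?ler0n // -[in leLHS](count_interval tl) natr_sum.
  apply: ler_sum => b _; have [hb|_] := boolP (t <= b < t + l)%N; last exact: ler0n.
  by rewrite fab.
rewrite mulr1 expr2 {1}/avg mulrAC ler_wpM2r ?invr_ge0 ?ler0n //.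
apply: le_trans (ler_sum _ (fun a _ => inner a)).
by rewrite -mulr_suml -natr_sum (count_interval sl).
Qed.

Lemma count_ge_rev (A : {set T}) (w : conf) y : (y <= M)%N ->
  count_ge A (rev_all w) y = (#|A| - count_ge A w (M - y))%N.
Proof.
move=> yM; rewrite /count_ge -[in RHS](cardsID [set z | (M - y <= w z)%N] A).
rewrite (_ : A :&: _ = [set z in A | (M - y <= w z)%N]); last by apply/setP => z; rewrite !inE.
rewrite addKn; apply: eq_card => z; rewrite !inE ffunE /= andbC; congr (_ && _).
by have := ltn_ord (w z); lia.
Qed.

Lemma count_ge_le (A : {set T}) (w : conf) y : (count_ge A w y <= #|A|)%N.
Proof. by apply: subset_leq_card; apply/subsetP => z; rewrite inE => /andP[]. Qed.

Lemma count_ge_anti (A : {set T}) (w : conf) y y' : (y <= y')%N -> (count_ge A w y' <= count_ge A w y)%N.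
Proof.
move=> yy'; apply: subset_leq_card; apply/subsetP => z; rewrite !inE => /andP[-> /=].
exact: leq_trans.
Qed.

Lemma is_gap_rev (A : {set T}) j m (w : conf) y0 : (j <= #|A|)%N ->
  is_gap A j m (rev_all w) y0 -> is_gap A (#|A| - j) m w (M - m - y0).
Proof.
move=> jA /[dup] /andP[ym _] /is_gapP gap; rewrite /is_gap; apply/andP; split; first lia.
apply/forallP => y; apply/implyP => yy.
have := gap (M - y)%N; rewrite count_ge_rev ?leq_subr //.
have -> : (M - (M - y) = y)%N by have := ltn_ord y; lia.
by move=> <-; [rewrite subKn ?count_ge_le | have := ltn_ord y; lia].
Qed.

(** A vertex of level a sees the threshold M - a, so two vertices are joined when their thresholds
    add up to at most M. The number y + z + m is the sum of the midpoints of the two windows. *)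
Definition gap_pair (A B : {set T}) (i j m : nat) (le : rel nat) (w : conf) : bool :=
  [exists y : 'I_M.+1, exists z : 'I_M.+1,
    [&& is_gap A i m w y, is_gap B j m w z & le (y + z + m)%N M]].

Lemma gap_pairP A B i j m (le : rel nat) (w : conf) :
  reflect (exists y z, [/\ is_gap A i m w y, is_gap B j m w z & le (y + z + m)%N M])
    (gap_pair A B i j m le w).
Proof.
apply: (iffP existsP) => [[y /existsP[z /and3P[h1 h2 h3]]]|[y [z [h1 h2 h3]]]].
  by exists y, z.
have yM : (y < M.+1)%N by case/andP: h1; lia.
have zM : (z < M.+1)%N by case/andP: h2; lia.
by exists (Ordinal yM); apply/existsP; exists (Ordinal zM); rewrite h1 h2 h3.
Qed.

(** Reflection turns i values above a window into j, since both sets have i + j elements. So the two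
    sets exchange roles and the comparison is reversed. *)
Lemma gap_pair_rev (A B : {set T}) i j m (b : bool) (w : conf) :
  #|A| = (i + j)%N -> #|B| = (i + j)%N ->
  gap_pair A B i j m (fun x y => if b then x <= y else y <= x)%N (rev_all w) ->
  gap_pair B A i j m (fun x y => if b then y <= x else x <= y)%N w.
Proof.
move=> cA cB /gap_pairP[y [z [gy gz yz]]]; apply/gap_pairP.
have yM : (y + m <= M)%N by case/andP: gy.
have zM : (z + m <= M)%N by case/andP: gz.
exists (M - m - z)%N, (M - m - y)%N; split.
- by rewrite -[i in is_gap _ i](addnK j) -cB; apply: is_gap_rev; rewrite // cB leq_addl.
- by rewrite -[j in is_gap _ j](addKn i) -cA; apply: is_gap_rev; rewrite // cA leq_addr.
- by move: yz; case: b; lia.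
Qed.

Lemma gap_pair_total (A B : {set T}) i j m (w : conf) :
  has_gap A i m w -> has_gap B j m w ->
  gap_pair A B i j m (fun x y => x <= y)%N w || gap_pair A B i j m (fun x y => y <= x)%N w.
Proof.
move=> /existsP[y gy] /existsP[z gz]; case: (leqP (y + z + m) M) => h; apply/orP.
  by left; apply/gap_pairP; exists y, z.
by right; apply/gap_pairP; exists y, z; split=> //; apply: ltnW.
Qed.

(* This symmetry replaces a comparison of order statistics of two possibly
   overlapping samples: the two events cover the existence of both gaps. *)
Lemma expect_gap_pair_swap (A B : {set T}) i j m :
  #|A| = (i + j)%N -> #|B| = (i + j)%N ->
  E (fun w => (gap_pair A B i j m (fun x y => x <= y)%N w)%:R) =
  E (fun w => (gap_pair B A i j m (fun x y => y <= x)%N w)%:R).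
Proof.
move=> cA cB; rewrite -[LHS](@expect_rev_all R T M); apply: eq_expect => w.
congr (nat_of_bool _)%:R; apply/idP/idP; first exact: (@gap_pair_rev A B i j m true).
rewrite -{1}(_ : rev_all (rev_all w) = w).
  exact: (@gap_pair_rev B A i j m false).
by apply/ffunP => z; rewrite !ffunE rev_ordK.
Qed.
End TwoCoords.

Section Candidates.
Variables (R : realFieldType) (T : finType) (M : nat) (g : rel T) (d : nat).
Variables (Sp : {set T}) (rho : T -> T).
Hypotheses (sg : symmetric g) (ig : irreflexive g) (rg : regular_graph g d).
Local Notation conf := {ffun T -> 'I_M}.
Local Notation E := (@expect R T M).
Local Notation threshold_graph := (@threshold_graph T M g Sp rho).
Local Notation level := (@level T M Sp rho).

Definition others (u v : T) : {set T} := [set z | g u z] :\ v.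

Lemma card_others u v : g u v -> #|others u v| = d.-1.
Proof. by move=> guv; have := cardsD1 v [set z | g u z]; rewrite inE guv -/(deg g u) rg /others => ->. Qed.

Lemma count_ge_upd (A : {set T}) (w : conf) z a y : z \notin A ->
  count_ge A (upd w z a) y = count_ge A w y.
Proof.
move=> zA; apply: eq_card => x; rewrite !inE; have [xA|//] := boolP (x \in A).
by rewrite upd_neq //; apply: contraNneq zA => <-.
Qed.

Lemma deg_thr_free (w : conf) u v : g u v -> u \notin closed_nbhd g Sp ->
  deg (threshold_graph w) u = ((M <= w u + w v) + count_ge (others u v) w (M - w u))%N.
Proof.
move=> guv uS.
have lev z : (z == u) || g u z -> level w z = w z.
  move=> zu; rewrite /level; case: ifP => // zS; case/negP: uS.
  by case/orP: zu => [/eqP<-|uz]; [apply: mem_nbhd | apply: (adj_nbhd zS); rewrite sg].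
rewrite /deg (cardsD1 v) inE /threshold_graph guv !lev ?eqxx ?guv ?orbT //=; congr (_ + _)%N.
apply: eq_card => z; rewrite !inE.
case: (z == v) => //=; case guz: (g u z) => //=.
by rewrite !lev ?eqxx ?guz ?orbT // leq_subLR.
Qed.

Lemma cand_free (w : conf) u v e i j : g u v ->
  u \notin closed_nbhd g Sp -> v \notin closed_nbhd g Sp ->
  (M <= w u + w v)%N = e ->
  count_ge (others u v) w (M - w u) = i -> count_ge (others v u) w (M - w v) = j ->
  (u, v) \in candidates g (threshold_graph w) (e, e + i, e + j)%N.
Proof.
move=> guv uS vS ew ci cj; have gvu : g v u by rewrite sg.
rewrite inE /= guv (deg_thr_free w guv uS) (deg_thr_free w gvu vS) addnC.
rewrite [(w v + w u)%N]addnC ew ci cj [(i + e)%N]addnC !eqxx !andbT /=.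
rewrite /threshold_graph guv /= /level.
have nS z : z \notin closed_nbhd g Sp -> (z \in Sp) = false.
  by move=> zS; apply: contraNF zS; apply: mem_nbhd.
by rewrite !nS // ew.
Qed.

Lemma upd2E (w : conf) u v a b : u != v ->
  (upd (upd w u a) v b u = a) * (upd (upd w u a) v b v = b).
Proof. by move=> uv; rewrite upd_neq // !upd_at. Qed.

Lemma count_ge_upd2 (w : conf) u v a b y :
  (count_ge (others u v) (upd (upd w u a) v b) y = count_ge (others u v) w y) *
  (count_ge (others v u) (upd (upd w u a) v b) y = count_ge (others v u) w y).
Proof.
by split; rewrite !count_ge_upd //; rewrite !inE ?eqxx ?ig ?andbF.
Qed.

Lemma expect_nonadjacent u v i j l : g u v -> (0 < M)%N ->
  u \notin closed_nbhd g Sp -> v \notin closed_nbhd g Sp ->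
  (l%:R / M%:R) ^+ 2 * E (fun w =>
     (gap_pair (others u v) (others v u) i j (2 * l) (fun x y => y <= x)%N w)%:R)
  <= E (fun w => ((u, v) \in candidates g (threshold_graph w) (false, i, j))%:R).
Proof.
move=> guv M_gt0 uS vS; have uv : u != v by apply: contraTneq guv => ->; rewrite ig.
apply: (@expect_two_coords R T M (fun w => (u, v) \in candidates g (threshold_graph w) (false, i, j))
  (gap_pair (others u v) (others v u) i j (2 * l) (fun x y => y <= x)%N) u v l M_gt0) => w.
move=> /gap_pairP[y [z [/[dup] gy /is_gapP hy /[dup] gz /is_gapP hz yz]]].
have yM : (y + 2 * l <= M)%N by case/andP: gy.
have zM : (z + 2 * l <= M)%N by case/andP: gz.
(* These levels put both thresholds in the upper halves of their windows, so the thresholds add up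
   to more than y + z + 2 l >= M and the ends are not joined. *)
exists (M - y - 2 * l)%N, (M - z - 2 * l)%N; split; [lia|lia|] => a b ha hb.
apply: (@cand_free _ u v false i j); rewrite ?(upd2E w a b uv) ?count_ge_upd2 //.
- by apply/negbTE; rewrite -ltnNge; lia.
- by apply: hy; lia.
- by apply: hz; lia.
Qed.

Lemma expect_adjacent u v i j l : g u v -> (0 < M)%N ->
  u \notin closed_nbhd g Sp -> v \notin closed_nbhd g Sp ->
  (l%:R / M%:R) ^+ 2 * E (fun w =>
     (gap_pair (others u v) (others v u) i j (2 * l) (fun x y => x <= y)%N w
      && has_gap (others u v) i.+1 (2 * l) w)%:R)
  <= E (fun w => ((u, v) \in candidates g (threshold_graph w) (true, i.+2, j.+1))%:R).
Proof.
move=> guv M_gt0 uS vS; have uv : u != v by apply: contraTneq guv => ->; rewrite ig.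
apply: (@expect_two_coords R T M (fun w => (u, v) \in candidates g (threshold_graph w) (true, i.+2, j.+1))
  (fun w => gap_pair (others u v) (others v u) i j (2 * l) (fun x y => x <= y)%N w
      && has_gap (others u v) i.+1 (2 * l) w) u v l M_gt0) => w.
move=> /andP[/gap_pairP[y [z [/[dup] gy /is_gapP hy /[dup] gz /is_gapP hz yz]]]].
move=> /existsP[x /[dup] gx /is_gapP hx].
have yM : (y + 2 * l <= M)%N by case/andP: gy.
have zM : (z + 2 * l <= M)%N by case/andP: gz.
have xM : (x + 2 * l <= M)%N by case/andP: gx.
(* The window with the larger count lies entirely below the other. Moving [u] into it only raises
   the level of [u], so the ends stay joined. *)
have xy : (x + 2 * l < y)%N.
  rewrite ltnNge; apply/negP => yx.
  have := count_ge_anti (others u v) w yx.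
  by rewrite (hy y) ?(hx (x + 2 * l)%N) ?leqnn ?leq_addr ?ltnn.
exists (M - x - 2 * l)%N, (M - z - 2 * l)%N; split; [lia|lia|] => a b ha hb.
apply: (@cand_free _ u v true i.+1 j); rewrite ?(upd2E w a b uv) ?count_ge_upd2 //.
- lia.
- by apply: hx; lia.
- by apply: hz; lia.
Qed.

Definition free_edges : {set T * T} := [set p | [&& g p.1 p.2,
  p.1 \notin closed_nbhd g Sp & p.2 \notin closed_nbhd g Sp]].

Lemma card_free_edges : (#|T| * d <= #|free_edges| + 2 * (#|closed_nbhd g Sp| * d))%N.
Proof.
apply: leq_trans (leq_add (leqnn _) (card_incident (closed_nbhd g Sp) sg rg)).
have -> : (#|T| * d = #|[set p : T * T | g p.1 p.2]|)%N.
  rewrite -(card_pairs g) (eq_bigr (fun=> d)) ?sum_nat_const // => v _.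
  by rewrite -/(deg g v) rg.
rewrite -cardsUI; apply: leq_trans (leq_addr _ _).
apply: subset_leq_card; apply/subsetP => p; rewrite !inE => -> /=.
by case: (_ \in _) => //=; case: (_ \in _).
Qed.

Lemma free_edges_swap (F : T -> T -> R) :
  \sum_(p in free_edges) F p.1 p.2 = \sum_(p in free_edges) F p.2 p.1.
Proof.
rewrite [LHS](reindex_onto (fun p => (p.2, p.1)) (fun p => (p.2, p.1))) /=; last by case.
apply: eq_bigl => -[x y]; rewrite !inE /= eqxx andbT sg.
by rewrite [(y \notin _) && _]andbC.
Qed.

Lemma expect_sum_cand r : E (fun w => #|candidates g (threshold_graph w) r|%:R) >=
  \sum_(p in free_edges) E (fun w => (p \in candidates g (threshold_graph w) r)%:R).
Proof.
rewrite -expect_sum; apply: le_expect => w.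
rewrite -natr_sum ler_nat -big_mkcondr /= sum1_card.
by apply: subset_leq_card; apply/subsetP => p; rewrite unfold_in => /andP[].
Qed.

Hypotheses (d_gt0 : (0 < d)%N).

Section Gaps.
Variables (i j l : nat).
Hypotheses (ij : d = (i + j).+1) (hM : M = (8 * d * (2 * l).+1)%N).

Let M_gt0 : (0 < M)%N.
Proof. by rewrite hM !muln_gt0 d_gt0. Qed.

(** The value of [M] is chosen here: d - 1 neighbours and windows of length 2 l give a failure
    probability of at most (d - 1) (2 l + 1) / M < 1/8. *)
Lemma expect_others_gap u v k : g u v -> (k < d)%N ->
  7 / 8 <= E (fun w => (has_gap (others u v) k (2 * l) w)%:R).
Proof.
move=> guv kd.
have mM : (2 * l < M)%N by rewrite hM; have := leq_mul d_gt0 (leqnn (2 * l).+1); lia.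
have kA : (k <= #|others u v|)%N by rewrite card_others //; lia.
apply: le_trans (expect_has_gap R M_gt0 mM kA); rewrite card_others // hM.
rewrite lerBrDl -lerBrDr (_ : 1 - 7 / 8 = 1 / 8); last by lra.
rewrite mulrA ler_pdivrMr ?ltr0n ?muln_gt0 ?d_gt0 // -natrM -mulnA.
rewrite [in leRHS]natrM mulrA (_ : 1 / 8 * 8%:R = 1); last by lra.
by rewrite mul1r ler_nat leq_mul2r leq_pred orbT.
Qed.

Let P (le : rel nat) (p : T * T) :=
  E (fun w => (gap_pair (others p.1 p.2) (others p.2 p.1) i j (2 * l) le w)%:R).

(** Both gaps exist with probability at least 7/8 + 7/8 - 1 = 3/4, and then one of the two
    comparisons holds. Summed over ordered edges both comparisons weigh the same, so each gets
    3/8. *)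
Lemma sum_gap_pairs :
  3 / 8 * #|free_edges|%:R <= \sum_(p in free_edges) P (fun x y => x <= y)%N p /\
  3 / 8 * #|free_edges|%:R <= \sum_(p in free_edges) P (fun x y => y <= x)%N p.
Proof.
have sE : \sum_(p in free_edges) P (fun x y => x <= y)%N p =
          \sum_(p in free_edges) P (fun x y => y <= x)%N p.
  rewrite [RHS](free_edges_swap (fun x y => P (fun x y => y <= x)%N (x, y))).
  apply: eq_bigr => -[u v]; rewrite inE /= => /and3P[guv _ _].
  have gvu : g v u by rewrite sg.
  by apply: expect_gap_pair_swap; rewrite (card_others guv, card_others gvu) ij.
suff : 3 / 4 * #|free_edges|%:R <= \sum_(p in free_edges) P (fun x y => x <= y)%N p +
   \sum_(p in free_edges) P (fun x y => y <= x)%N p by rewrite sE; split; lra.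
rewrite -big_split /= mulr_natr -sumr_const; apply: ler_sum => -[u v].
rewrite inE /= => /and3P[guv _ _].
have gvu : g v u by rewrite sg.
have h1 : 7 / 8 <= E (fun w => (has_gap (others u v) i (2 * l) w)%:R).
  by apply: expect_others_gap => //; rewrite ij; lia.
have h2 : 7 / 8 <= E (fun w => (has_gap (others v u) j (2 * l) w)%:R).
  by apply: expect_others_gap => //; rewrite ij; lia.
rewrite /P /= -expectD; apply: (@le_trans _ _ (E (fun w =>
  (has_gap (others u v) i (2 * l) w)%:R + (has_gap (others v u) j (2 * l) w)%:R - 1))).
  by rewrite expectB expectD expect_cst //; lra.
apply: le_expect => w.
have := @gap_pair_total _ _ (others u v) (others v u) i j (2 * l) w.
case: (has_gap (others u v) _ _ w); case: (has_gap (others v u) _ _ w).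
- move=> /(_ isT isT) /orP[] -> /=.
    by rewrite (_ : 1 + 1 - 1 = 1 :> R) ?lerDl //; ring.
  by rewrite (_ : 1 + 1 - 1 = 1 :> R) ?lerDr //; ring.
- by move=> _; rewrite addr0 subrr addr_ge0.
- by move=> _; rewrite add0r subrr addr_ge0.
- by move=> _; rewrite add0r sub0r; apply: le_trans (_ : 0 <= _); rewrite ?addr_ge0 // lerN10.
Qed.

(** The extra gap needed for an edge that is present costs 1/8, whence the common factor 1/4 = 3/8 -
    1/8. *)
Lemma expect_card_cand (e : bool) : (e -> i.+1 < d)%N ->
  (l%:R / M%:R) ^+ 2 * (#|free_edges|%:R / 4) <=
  E (fun w => #|candidates g (threshold_graph w) (if e then (true, i.+2, j.+1) else (false, i, j))|%:R).
Proof.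
move=> ed; apply: le_trans (expect_sum_cand _).
have [s1 s2] := sum_gap_pairs.
have F0 : 0 <= #|free_edges|%:R :> R by [].
case: e ed => ed.
  apply: (@le_trans _ _ (\sum_(p in free_edges) (l%:R / M%:R) ^+ 2 * (P (fun x y => x <= y)%N p - 1 / 8))).
    rewrite -mulr_sumr ler_wpM2l ?sqr_ge0 // sumrB sumr_const -[_ *+ _]mulr_natr; lra.
  apply: ler_sum => -[u v]; rewrite inE /= => /and3P[guv uS vS].
  apply: le_trans (expect_adjacent i j l guv M_gt0 uS vS).
  rewrite ler_wpM2l ?sqr_ge0 //.
  have := expect_others_gap guv (ed isT) => h1.
  apply: (@le_trans _ _ (P (fun x y => x <= y)%N (u, v) +
     E (fun w => (has_gap (others u v) i.+1 (2 * l) w)%:R) - 1)); first by lra.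
  rewrite /P -[X in _ - X](expect_cst T M_gt0) -expectD -expectB; apply: le_expect => w /=.
  case: (gap_pair _ _ _ _ _ _ _); case: (has_gap _ _ _ _) => /=; lra.
apply: (@le_trans _ _ (\sum_(p in free_edges) (l%:R / M%:R) ^+ 2 * P (fun x y => y <= x)%N p)).
  rewrite -mulr_sumr ler_wpM2l ?sqr_ge0 //; lra.
apply: ler_sum => -[u v]; rewrite inE /= => /and3P[guv uS vS].
exact: expect_nonadjacent.
Qed.
End Gaps.
End Candidates.

(** * Correcting the degrees *)

Section Correct.
Variables (T : finType) (g : rel T) (d : nat) (q : 'I_d.+1 -> nat).
Hypotheses (gg : simple_graph g) (rg : regular_graph g d) (d_gt1 : (1 < d)%N).

Lemma deg_sum_even (h : rel T) : simple_graph h -> ~~ odd (\sum_v deg h v).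
Proof.
move=> [sh ih]; rewrite /deg (card_pairs h).
pose P := [set p : T * T | h p.1 p.2].
pose L := [set p : T * T | (enum_rank p.1 < enum_rank p.2)%N].
rewrite -/P -(cardsID L P).
suff -> : #|P :\: L| = #|P :&: L| by rewrite addnn odd_double.
pose s (p : T * T) := (p.2, p.1).
have sK : involutive s by case.
rewrite -(card_imset _ (inv_inj sK)); apply: eq_card => p.
rewrite -[p in LHS]sK mem_imset; last exact: inv_inj.
rewrite !inE /= [h p.2 p.1]sh -leqNgt; case hp: (h p.1 p.2); rewrite ?andbF //= andbT.
rewrite leq_eqVlt val_eqE (inj_eq enum_rank_inj).
by case: eqP hp => [->|//]; rewrite ih.
Qed.

(** At i = 0 the truncated [i.-1] is harmless, since a deficit at level 0 vanishes. *)
Lemma second_difference i x :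
  ((i.+1 - x) + (i.-1 - x) = 2 * (i - x) + (x == i))%N.
Proof. by case: i => [|i] /=; case: eqP; lia. Qed.

Definition target (c : nat) : nat := \sum_(i < d.+1) q i * (c - i).

Lemma degree_count_deficit (h : rel T) :
  (forall c, (c <= d.+1)%N -> deficit h c = target c) ->
  forall i : 'I_d.+1, degree_count h i = q i.
Proof.
move=> hc i.
have hS : (deficit h i.+1 + deficit h i.-1 = 2 * deficit h i + degree_count h i)%N.
  rewrite /deficit -big_split big_distrr /= (eq_bigr _ (fun v _ => second_difference i (deg h v))).
  rewrite big_split /=; congr (_ + _)%N.
  by rewrite /degree_count -sum1_card -big_mkcond /=; apply: eq_bigl => v; rewrite inE.
have tS : (target i.+1 + target i.-1 = 2 * target i + q i)%N.
  rewrite /target -big_split big_distrr /=.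
  rewrite (eq_bigr (fun k : 'I_d.+1 => 2 * (q k * (i - k)) + (if k == i then q k else 0))%N).
    by rewrite big_split /= -big_mkcond big_pred1_eq.
  move=> k _; rewrite -mulnDr second_difference mulnDr mulnCA; congr (_ + _)%N.
  by rewrite val_eqE; case: (k == i); rewrite ?muln1 ?muln0.
have iD := ltn_ord i; move: hS; rewrite !hc; lia.
Qed.

Lemma deficit_top (h : rel T) c : subrel h g -> (d <= c)%N ->
  (deficit h c + \sum_v deg h v = #|T| * c)%N.
Proof.
move=> hg dc; rewrite /deficit -big_split /= -sum_nat_const; apply: eq_bigr => v _.
have : (deg h v <= d)%N.
  by rewrite -(rg v); apply: subset_leq_card; apply/subsetP => x; rewrite !inE => /hg.
lia.
Qed.

Lemma target_top c : (\sum_i q i)%N = #|T| -> (d <= c)%N ->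
  (target c + \sum_(i < d.+1) i * q i = #|T| * c)%N.
Proof.
move=> <- dc; rewrite /target -big_split /= big_distrl /=; apply: eq_bigr => i _.
by rewrite [(i * _)%N]mulnC -mulnDr subnK //; have := ltn_ord i; lia.
Qed.

Definition flip_request (e : bool) (j : nat) : bool * nat * nat :=
  if e then (true, j.+2, (d - j)%N) else (false, j, (d.-1 - j)%N).

(* With k = d - 1 - j, the first flip takes degrees j, k to j + 1, k + 1 and the
   second takes j + 2, k + 1 to j + 1, k. *)
Lemma flip_effect_pair j c : (j < d.-1)%N ->
  flip_effect c (flip_request false j) + flip_effect c (flip_request true j) =
  - (c == j.+1)%:Z.
Proof. by rewrite /flip_effect /flip_request /=; case: eqP; lia. Qed.

Lemma sum_nseq_effect c k r :
  \sum_(x <- nseq k r) flip_effect c x = flip_effect c r *+ k.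
Proof. by rewrite big_nseq -Monoid.iteropE -/(GRing.natmul _ _). Qed.

Lemma correct_degrees (h0 : rel T) (lam X B : nat) :
  spanning_subgraph h0 g ->
  (\sum_i q i)%N = #|T| -> ~~ odd (\sum_(i < d.+1) i * q i) ->
  (forall e j, (j < d.-1)%N -> (B <= #|candidates g h0 (flip_request e j)|)%N) ->
  (deficit h0 d <= target d + 2 * lam)%N -> (target d <= deficit h0 d + 2 * lam)%N ->
  (forall c, (0 < c < d)%N -> (target c + lam <= deficit h0 c <= target c + X)%N) ->
  (4 * d * (lam + 2 * (d * (X + lam))) <= B)%N ->
  exists2 h, spanning_subgraph h g & forall i : 'I_d.+1, degree_count h i = q i.
Proof.
move=> sp sq eq hB up lo mid hsz.
have hg : subrel h0 g by case: sp.
(* S(d) encodes the number of edges, which paired flips preserve, so it is repaired beforehand by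
   single flips. Each changes S(d) by 2, so by parity [k0] of them are exact, and each moves the
   other S(c) by at most 1. *)
pose e0 := (deficit h0 d < target d)%N.
pose k0 := (if e0 then target d - deficit h0 d else deficit h0 d - target d)%N./2.
pose r0 := flip_request e0 0.
pose mid_deficit c := (deficit h0 c)%:Z + flip_effect c r0 *+ k0.
(* The margin [lam] outweighs the [k0] single flips, so this surplus is nonnegative and [absz]
   changes nothing. *)
pose G j := absz (mid_deficit j.+1 - (target j.+1)%:Z).
pose moves j := nseq (G j) (flip_request false j) ++ nseq (G j) (flip_request true j).
pose reqs := nseq k0 r0 ++ flatten [seq moves j | j <- iota 0 d.-1].
have k0lam : (k0 <= lam)%N by rewrite /k0 /e0; case: ltnP; lia.
have par : odd (deficit h0 d) = odd (target d).
  have h1 := deficit_top hg (leqnn d); have h2 := target_top sq (leqnn d).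
  have := deg_sum_even (proj1 sp); move: h1 h2 eq; lia.
have mid_d : mid_deficit d = target d.
  rewrite /mid_deficit /r0 /k0 /e0 /flip_effect /flip_request.
  case: ltnP => h /=; rewrite -[_ *+ _]mulr_natr ?subn0; lia.
have eff0 c : (c < d)%N -> - (1 : int) <= flip_effect c r0 <= 1.
  rewrite /r0; case: (e0) => cd.
    have -> : flip_effect c (flip_request true 0) =
      (1 < c)%N%:Z + (d - 0 <= c)%N%:Z by [].
    lia.
  have -> : flip_effect c (flip_request false 0) =
    - ((0 < c)%N%:Z + (d.-1 - 0 < c)%N%:Z) by [].
  lia.
have midG c : (0 < c < d)%N -> mid_deficit c = (target c + G c.-1)%N /\ (G c.-1 <= X + lam)%N.
  move=> /[dup] cd /mid; have := eff0 c; rewrite /G /mid_deficit prednK; last by case/andP: cd.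
  rewrite -mulr_natr; move: (flip_effect c r0) => f /(_ _) h1 h2.
  have {h1}h1 : -1 <= f <= 1 by apply: h1; case/andP: cd.
  have h3 : - (k0%:Z) <= f * k0%:R <= k0%:Z by nia.
  lia.
have szmoves : (size (flatten [seq moves j | j <- iota 0 d.-1]) <= 2 * (d * (X + lam)))%N.
  rewrite size_flatten /shape -map_comp sumnE big_map.
  apply: leq_trans (_ : \sum_(j <- iota 0 d.-1) 2 * (X + lam) <= _)%N.
    rewrite !big_seq; apply: leq_sum => j; rewrite mem_iota => /= jd.
    rewrite /moves size_cat !size_nseq.
    have [|_] := midG j.+1; first lia.
    by rewrite /=; lia.
  by rewrite big_const_seq count_predT size_iota iter_addn_0; nia.
have cands r : r \in reqs -> (4 * d * size reqs <= #|candidates g h0 r|)%N.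
  move=> rr; apply: leq_trans (leq_trans hsz _).
    by rewrite leq_mul // /reqs size_cat size_nseq leq_add.
  move: rr; rewrite mem_cat => /orP[].
    by rewrite mem_nseq => /andP[_ /eqP->]; apply: hB; lia.
  move=> /flatten_mapP[j]; rewrite mem_iota => /= jd.
  by rewrite mem_cat !mem_nseq => /orP[] /andP[_ /eqP->]; apply: hB; lia.
have d_gt0 : (0 < d)%N by lia.
have [h sph hc] := disjoint_flips gg rg d_gt0 sp cands.
exists h => //; apply: degree_count_deficit.
have hsum c : (deficit h c)%:Z = mid_deficit c - (if (0 < c < d)%N then G c.-1 else 0)%N%:Z.
  rewrite hc big_cat /= sum_nseq_effect addrA; congr (_ + _).
  rewrite big_flatten big_map /=.
  rewrite (eq_big_seq (fun j => - ((c == j.+1) * G j)%N%:Z)); last first.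
    move=> j; rewrite mem_iota => /= jd.
    rewrite /moves big_cat /= !sum_nseq_effect -mulrnDl.
    have /(flip_effect_pair c)/= -> : (j < d.-1)%N by lia.
    by rewrite -mulr_natr; case: (_ == _) => /=; lia.
  rewrite sumrN; congr (- _).
  case: ifP => [cd|cd].
    rewrite (bigD1_seq c.-1) ?mem_iota ?iota_uniq //=; last lia.
    rewrite prednK ?eqxx; last by case/andP: cd.
    rewrite mul1n big1_seq ?addr0 // => j /andP[jc _].
    by rewrite (_ : (c == j.+1) = false) //; apply/eqP; lia.
  rewrite big1_seq // => j /andP[_]; rewrite mem_iota => /= jd.
  by rewrite (_ : (c == j.+1) = false) //; apply/eqP; lia.
have hd : deficit h d = target d.
  by apply/eqP; rewrite -eqz_nat hsum mid_d ltnn andbF subr0.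
move=> c; rewrite leq_eqVlt => /orP[/eqP->|].
  (* From d to d + 1 both the deficit and the target grow by |T|. *)
  have [_ hg'] := sph.
  have := deficit_top hg' (leqnn d); have := target_top sq (leqnn d).
  have := deficit_top hg' (leqnSn d); have := target_top sq (leqnSn d).
  lia.
rewrite ltnS leq_eqVlt => /orP[/eqP->//|cd].
case: (posnP c) => [->|c0].
  rewrite /deficit /target !big1 // => i _; rewrite ?sub0n ?muln0 //.
apply/eqP; rewrite -eqz_nat hsum c0 cd /=.
have [|-> _] := midG c; first lia.
by apply/eqP; lia.
Qed.
End Correct.

(** * Choosing the configuration *)

Section Random.
Variables (R : realFieldType) (T : finType) (g : rel T) (d s : nat).
Hypotheses (gg : simple_graph g) (rg : regular_graph g d) (d_gt1 : (1 < d)%N).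
Local Notation N := (#|T|%:R).
Local Notation D := (d%:R).
Local Notation S := (s%:R).
Hypotheses (Ns : N <= S ^+ 2 :> R) (KN : 2 ^+ 25 * D ^+ 6 * S < N :> R).

(** Chebyshev with differences 6 d bounds each deviation beyond [lam] by 1 / (4 d^2) <= 1 / (8 d).
    The number [r] makes the guaranteed surplus 2 r / (6 d) equal to 3 [lam]: for the fluctuation,
    for the rounding d^2 of the target, and for the margin asked by [correct_degrees]. *)
Let lam : R := 12 * D ^+ 2 * S.
Let r : nat := (108 * d ^ 3 * s)%N.

Lemma size_bounds : [/\ 2 <= D :> R, 1 <= S :> R & 2 ^+ 50 * D ^+ 12 < N :> R].
Proof.
have D2 : 2 <= D :> R by rewrite ler_nat.
have D0 : 0 < D :> R by lra.
have S1 : 1 <= S :> R.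
  rewrite ler1n lt0n; apply/eqP => s0; move: Ns KN.
  by rewrite s0 expr0n mulr0 /= => h1 h2; have := lt_le_trans h2 h1; rewrite ltxx.
split=> //; apply: le_lt_trans KN.
have h : 2 ^+ 25 * D ^+ 6 < S :> R.
  by have := lt_le_trans KN Ns; rewrite expr2 ltr_pM2r //; lra.
rewrite (_ : 2 ^+ 50 * D ^+ 12 = 2 ^+ 25 * D ^+ 6 * (2 ^+ 25 * D ^+ 6) :> R); last by ring.
by rewrite ler_wpM2l ?ltW // mulr_gt0 ?exprn_gt0.
Qed.

Lemma pair_number_natr : r%:R = 108 * (D ^+ 3 * S) :> R.
Proof. by rewrite /r natrM natrM natrX mulrA. Qed.

Lemma pow_step k : D ^+ k * S * 2 <= D ^+ k.+1 * S :> R.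
Proof.
have [D2 S1 _] := size_bounds.
rewrite exprSr mulrAC ler_wpM2r ?(le_trans ler01 S1) //.
by rewrite ler_wpM2l // exprn_ge0 //; lra.
Qed.

Lemma pow_gt0 k : 0 < D ^+ k * S :> R.
Proof.
by have [D2 S1 _] := size_bounds; rewrite mulr_gt0 ?exprn_gt0 //; lra.
Qed.

Lemma pairs_fit : (2 * r * d.+1 ^ 3 < #|T|)%N.
Proof.
have [D2 S1 _] := size_bounds.
rewrite -(ltr_nat R); apply: le_lt_trans KN; rewrite natrM natrM pair_number_natr natrX -natr1.
have h : (D + 1) ^+ 3 <= 27 / 8 * D ^+ 3 :> R.
  apply: (@le_trans _ _ ((3 / 2 * D) ^+ 3)); last by rewrite exprMn; lra.
  have e1 : 0 <= D + 1 :> R by lra.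
  have e2 : 0 <= 3 / 2 * D :> R by lra.
  have e3 : D + 1 <= 3 / 2 * D :> R by lra.
  by apply: lerXn2r; rewrite ?nnegrE.
have p3 := pow_gt0 3; have p6 := pow_gt0 6.
apply: le_trans (_ : 2 * (108 * (D ^+ 3 * S)) * (27 / 8 * D ^+ 3) <= _).
  by rewrite ler_wpM2l //; lra.
have -> : 2 * (108 * (D ^+ 3 * S)) * (27 / 8 * D ^+ 3) = 729 * (D ^+ 6 * S) :> R by field.
by rewrite -[leRHS]mulrA ler_wpM2r ?ltW //; lra.
Qed.

(** This is Chebyshev for the candidate counts: with differences 9 d^2 and deviation n / (96^2 d) it
    gives failure probability at most 1 / (4 d). *)
Lemma tail_bound : 324 * (96 * 96) ^+ 2 * D ^+ 7 <= N :> R.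
Proof.
have [D2 S1 NK] := size_bounds.
have D1 : 1 <= D ^+ 5 :> R by apply: exprn_ege1; lra.
have D7 : 0 < D ^+ 7 :> R by rewrite exprn_gt0 //; lra.
apply: le_trans (ltW NK).
rewrite (_ : 2 ^+ 50 * D ^+ 12 = 2 ^+ 50 * D ^+ 5 * D ^+ 7 :> R); last by ring.
rewrite ler_wpM2r ?ltW //; lra.
Qed.

(** For 0 < c < d the product c (d - c) is smallest at the ends, where it is d - 1, and 3 (d - 1) >=
    d + 1. At c = d the excess vanishes. *)
Lemma excess_bounds c : (0 < c <= d)%N ->
  (c < d)%N%:R / (6 * D) <= excess R d c <= 1 / 2 * (c < d)%N%:R.
Proof.
have [D2 _ _] := size_bounds; move=> /andP[c0 cd].
rewrite /excess -[d.+1%:R]natr1.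
have x1 : 1 <= c%:R :> R by rewrite ler1n.
have [cd'|dc] := ltnP c d; last first.
  have -> : c = d by lia.
  by rewrite subrr mulr0 !mul0r mulr0 lexx.
have xy : c%:R + 1 <= D :> R by rewrite natr1 ler_nat.
move: (c%:R) D D2 x1 xy => x y D2 x1 xy.
have p : 0 < 2 * y * (y + 1) by nra.
rewrite mulr1n mulr1; apply/andP; split.
  have q : y - 1 <= x * (y - x) by nra.
  rewrite ler_pdivrMr; last lra.
  have -> : x * (y - x) / (2 * y * (y + 1)) * (6 * y) = 3 * (x * (y - x)) / (y + 1).
    by field; rewrite !gt_eqF //; lra.
  rewrite ler_pdivlMr; lra.
by rewrite ler_pdivrMr //; nra.
Qed.

(** The [M] required for windows of length 2 l with l = |T|: fine enough that ties cost at most 1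
    over all vertices together, while l / M is still at least 1 / (24 d). *)
Definition levels : nat := (8 * d * (2 * #|T|).+1)%N.

Lemma levelsE : levels%:R = 8 * D * (2 * N + 1) :> R.
Proof. by rewrite /levels natrM natrM -[(2 * #|T|).+1%:R]natr1 natrM. Qed.

Lemma levels_gt0 : (0 < levels)%N.
Proof. by rewrite /levels !muln_gt0 (ltnW d_gt1). Qed.

Section Choice.
Variables (Sp : {set T}) (rho : T -> T).
Hypotheses (pS : pair_system g Sp rho) (cS : #|Sp| = (2 * r)%N).
Local Notation conf := {ffun T -> 'I_levels}.
Local Notation E := (@expect R T levels).
Local Notation threshold_graph := (@threshold_graph T levels g Sp rho).

(** At least half of the n d ordered edges are free, and (1 / (24 d))^2 (n d / 2) / 4 = 2 n / (96^2
    d). The factor 2 leaves room for a deviation of half the mean. *)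
Lemma expect_cand_large e j : (j < d.-1)%N ->
  2 * (N / (96 * 96 * D)) <= E (fun w => #|candidates g (threshold_graph w) (flip_request d e j)|%:R).
Proof.
move=> jd; have [sg ig] := gg; have [D2 S1 NK] := size_bounds.
have N0 : 0 < N :> R.
  by apply: le_lt_trans NK; rewrite mulr_ge0 ?exprn_ge0 //; lra.
have d0 : (0 < d)%N by lia.
have dE : d = (j + (d.-1 - j)).+1 by lia.
have ed : e -> (j.+1 < d)%N by lia.
have := expect_card_cand R Sp rho sg ig rg d0 (l := #|T|) dE (erefl levels) ed.
have -> : (if e then (true, j.+2, (d.-1 - j).+1) else (false, j, (d.-1 - j)%N)) =
    flip_request d e j.
  by rewrite /flip_request; case: e ed => // _; congr (_, _, _); lia.
apply: le_trans.
have F : N * D / 2 <= #|free_edges g Sp|%:R :> R.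
  have h1 := card_free_edges Sp sg rg.
  have h2 : (#|closed_nbhd g Sp| <= 2 * r * d.+1)%N by rewrite -cS; apply: card_nbhd.
  have h3 : N * D <= #|free_edges g Sp|%:R + 2 * (2 * r%:R * (D + 1) * D) :> R.
    rewrite -natrM natr1 -!natrM -natrD ler_nat; apply: leq_trans h1 _.
    by rewrite leq_add2l leq_mul2l /= leq_mul2r h2 orbT.
  have h4 : 8 * r%:R * (D + 1) <= N :> R.
    apply: le_trans (ltW KN); rewrite pair_number_natr.
    have p4 := pow_gt0 4; have p5 := pow_step 4; have p6 := pow_step 5; have p3 := pow_step 3.
    have -> : 8 * (108 * (D ^+ 3 * S)) * (D + 1) = 864 * (D ^+ 4 * S) + 864 * (D ^+ 3 * S) :> R by ring.
    rewrite -mulrA; lra.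
  have h5 : 8 * r%:R * (D + 1) * D <= N * D :> R by rewrite ler_wpM2r //; lra.
  lra.
apply: (@le_trans _ _ ((1 / (24 * D)) ^+ 2 * (N * D / 2 / 4))).
  have -> : (1 / (24 * D)) ^+ 2 * (N * D / 2 / 4) = 2 * (N / (96 * 96 * D)) :> R.
    by field; rewrite gt_eqF //; lra.
  exact: lexx.
apply: ler_pM; rewrite ?sqr_ge0 //.
- by rewrite !mulr_ge0 ?invr_ge0 //; lra.
- have n1 : 1 <= N :> R by rewrite ler1n -(ltr0n R).
  have e24 : 0 < 24 * D :> R by lra.
  have lev0 : 0 < 8 * D * (2 * N + 1) :> R by rewrite mulr_gt0 //; lra.
  have e1 : 1 / (24 * D) <= N / levels%:R :> R.
    rewrite levelsE ler_pdivrMr // mulrAC ler_pdivlMr //.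
    by have := ler_wpM2l (ltW e24) n1; lra.
  by apply: lerXn2r; rewrite ?nnegrE ?divr_ge0 ?ler0n ?ler01 ?(ltW e24).
- by lra.
Qed.

Lemma exists_good_conf : exists w : conf,
  (forall e j, (j < d.-1)%N ->
    N / (96 * 96 * D) <= #|candidates g (threshold_graph w) (flip_request d e j)|%:R :> R) /\
  (forall c, (0 < c <= d)%N ->
    `|(deficit (threshold_graph w) c)%:R - E (fun w => (deficit (threshold_graph w) c)%:R)| <= lam).
Proof.
have [sg ig] := gg; have [D2 S1 NK] := size_bounds.
have N0 : 0 < N :> R.
  by apply: le_lt_trans NK; rewrite mulr_ge0 ?exprn_ge0 //; lra.
have D0 : 0 < D :> R by lra.
pose t : R := N / (96 * 96 * D).
have t0 : 0 < t by rewrite divr_gt0 // mulr_gt0 //; lra.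
have lam0 : 0 < lam by rewrite !mulr_gt0 ?exprn_gt0 //; lra.
pose Bad (i : 'I_d + bool * 'I_d.-1) (w : conf) : bool :=
  match i with
  | inl c => lam <= `|(deficit (threshold_graph w) c.+1)%:R - E (fun w => (deficit (threshold_graph w) c.+1)%:R)|
  | inr (e, j) => t <= `|#|candidates g (threshold_graph w) (flip_request d e j)|%:R -
        E (fun w => #|candidates g (threshold_graph w) (flip_request d e j)|%:R)|
  end.
have [|w hw] := @union_bound R T levels levels_gt0 _ xpredT Bad.
  rewrite big_sumType /=.
  have b1 (c : 'I_d) : E (fun w => (Bad (inl c) w)%:R) <= 1 / (8 * D).
    apply: le_trans (chebyshev levels_gt0 (bounded_diff_deficit R sg ig rg pS c.+1) lam0) _.
    rewrite ler_pdivrMr ?exprn_gt0 // natrM.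
    have -> : 1 / (8 * D) * lam ^+ 2 = 18 * D ^+ 3 * S ^+ 2.
      by rewrite /lam; field; rewrite gt_eqF.
    apply: (@le_trans _ _ (S ^+ 2 * (6 * D) ^+ 2)); first by rewrite ler_wpM2r ?sqr_ge0.
    have := ler_wpM2r (mulr_ge0 (sqr_ge0 D) (sqr_ge0 S)) D2; lra.
  have b2 e (j : 'I_d.-1) : E (fun w => (Bad (inr (e, j)) w)%:R) <= 1 / (4 * D).
    apply: le_trans (chebyshev levels_gt0 (bounded_diff_cand R sg ig rg pS d_gt1 _) t0) _.
    rewrite ler_pdivrMr ?exprn_gt0 // natrM natrX.
    have -> : 1 / (4 * D) * t ^+ 2 = N ^+ 2 / (4 * (96 * 96) ^+ 2 * D ^+ 3).
      by rewrite /t; field; rewrite gt_eqF.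
    rewrite ler_pdivlMr; last by rewrite mulr_gt0 ?exprn_gt0 //; lra.
    have := ler_wpM2l (ltW N0) tail_bound.
    by rewrite (_ : N * (9 * D ^+ 2) ^+ 2 * (4 * (96 * 96) ^+ 2 * D ^+ 3) =
       N * (324 * (96 * 96) ^+ 2 * D ^+ 7)) ?expr2 //; ring.
  (* There are d events of probability at most 1 / (8 d) and 2 (d - 1) of probability at most 1 / (4
     d). *)
  apply: (@le_lt_trans _ _ (1 / 8 + 1 / 2)); last by lra.
  apply: lerD.
    apply: le_trans (ler_sum _ (fun c _ => b1 c)) _.
    have -> : \sum_(c < d) 1 / (8 * D) = 1 / 8 :> R.
      by rewrite sumr_const card_ord -[LHS]mulr_natr; field; rewrite gt_eqF.
    exact: lexx.
  apply: (@le_trans _ _ (\sum_(p : bool * 'I_d.-1) 1 / (4 * D))).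
    by apply: ler_sum => -[e j] _; apply: b2.
  rewrite sumr_const card_prod card_bool card_ord -[_ *+ _]mulr_natr natrM.
  have : d.-1%:R <= D :> R by rewrite ler_nat leq_pred.
  move=> h; apply: (@le_trans _ _ (1 / (4 * D) * (2 * D))).
    by rewrite ler_wpM2l ?divr_ge0 //; lra.
  have -> : 1 / (4 * D) * (2 * D) = 1 / 2 :> R by field; rewrite gt_eqF.
  exact: lexx.
exists w; split.
  move=> e j jd; have := hw (inr (e, Ordinal jd)) isT; rewrite /= -ltNge ltr_norml => /andP[h _].
  by have := expect_cand_large e jd; rewrite -/t; lra.
move=> [//|c] /andP[_ cd]; have := hw (inl (Ordinal cd)) isT.
by rewrite /= -ltNge => /ltW.
Qed.

End Choice.
Lemma target_near (q : 'I_d.+1 -> nat) c :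
  (forall i, `|(q i)%:R - N / d.+1%:R| <= 1 :> R) -> (c <= d)%N ->
  `|(target q c)%:R - N * mean_deficit R d c| <= D ^+ 2.
Proof.
move=> hq cd; have [D2 _ _] := size_bounds.
have tri := triangular_sum (leqW cd).
have -> : N * mean_deficit R d c = \sum_(i < d.+1) N / d.+1%:R * (c - i)%N%:R.
  rewrite -mulr_sumr -natr_sum /mean_deficit.
  have -> : c%:R * c.+1%:R = 2 * (\sum_(i < d.+1) (c - i))%N%:R :> R.
    by rewrite -!natrM tri.
  by field; rewrite addrC natr1 pnatr_eq0.
rewrite /target natr_sum -sumrB; apply: le_trans (ler_norm_sum _ _ _) _.
apply: (@le_trans _ _ (\sum_(i < d.+1) (c - i)%N%:R)).
  apply: ler_sum => i _; rewrite natrM -mulrBl normrM normr_nat.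
  by rewrite ler_piMl ?ler0n.
rewrite -natr_sum -natrX ler_nat -(leq_pmul2l (ltn0Sn 1)) tri.
by rewrite mul2n -addnn mulnS addnC leq_add // -?mulnn ?leq_mul //; nia.
Qed.

Lemma exists_exact_degrees (q : 'I_d.+1 -> nat) :
  (\sum_i q i)%N = #|T| -> ~~ odd (\sum_(i < d.+1) i * q i) ->
  (forall i, `|(q i)%:R - N / d.+1%:R| <= 1 :> R) ->
  exists2 h, spanning_subgraph h g & forall i : 'I_d.+1, degree_count h i = q i.
Proof.
move=> sq eq hq; have [D2 S1 NK] := size_bounds; have [sg ig] := gg.
have d0 : (0 < d)%N by lia.
have [Sp [rho [pS cS]]] := exists_pair_system sg ig rg d0 pairs_fit.
have [w [hN hS]] := exists_good_conf pS cS.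
have D0 : 0 < D :> R by lra.
have N0 : 0 <= N :> R by [].
have lev_even : ~~ odd levels by rewrite /levels !oddM.
pose lam' := (12 * d ^ 2 * s)%N.
have lamE : lam'%:R = lam by rewrite /lam' natrM natrM natrX.
have p0 := pow_gt0 2; have p1 := pow_step 2; have p2 := pow_step 3; have p3 := pow_step 4.
have lamS : lam = 12 * (D ^+ 2 * S) by rewrite /lam mulrA.
have DS : D ^+ 2 <= D ^+ 2 * S :> R by rewrite ler_peMr ?sqr_ge0.
have D4 : 4 <= D ^+ 2 :> R by rewrite expr2; nra.
have hE c : (0 < c <= d)%N -> N * mean_deficit R d c + 2 * r%:R * excess R d c - lam <=
   (deficit (threshold_graph g Sp rho w) c)%:R <= N * mean_deficit R d c + 2 * r%:R * excess R d c +
     (c < d)%N%:R * (2 * r%:R) + 1 + lam.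
  move=> cd; have := expect_deficit_bounds R sg ig rg pS d_gt1 levels_gt0 lev_even cS cd.
  have := hS c cd; rewrite ler_norml; cbn zeta.
  have tie : N * (D / levels%:R) <= 1 :> R.
    rewrite levelsE mulrA ler_pdivrMr; last by rewrite !mulr_gt0 //; lra.
    have := mulr_ge0 N0 (ltW D0); lra.
  move=> /andP[h1 h2] /andP[h3 h4]; apply/andP; split; lra.
have hq' c : (c <= d)%N -> - D ^+ 2 <= (target q c)%:R - N * mean_deficit R d c <= D ^+ 2.
  by move=> cd; rewrite -ler_norml; apply: target_near.
(* The surplus is at most [4 * r]: the gain 2 r [excess] is at most r, the spread of
   [expect_deficit_bounds] adds 2 r, and the last r covers [lam], ties and rounding. *)
apply: (@correct_degrees T g d q gg rg d_gt1 (threshold_graph g Sp rho w) lam' (4 * r)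
  (4 * d * (lam' + 2 * (d * (4 * r + lam'))))) => //.
- exact: thr_spanning.
- move=> e j jd; rewrite -(ler_nat R); apply: le_trans (hN e j jd).
  rewrite ler_pdivlMr; last lra.
  rewrite !natrM natrD natrM natrM natrD natrM lamE pair_number_natr lamS.
  apply: le_trans (ltW KN).
  have q1 : D ^+ 5 * S * 2 <= D ^+ 6 * S := pow_step 5.
  (* Since d >= 2, the three terms add up to at most 9216 * 3516 d^6 s, just below 2^25 d^6 s; this
     fixes the constant in [KN]. *)
  have -> : 4 * D * (12 * (D ^+ 2 * S) + 2 * (D * (4 * (108 * (D ^+ 3 * S)) +
     12 * (D ^+ 2 * S)))) * (96 * 96 * D) =
     9216 * (48 * (D ^+ 4 * S) + 3456 * (D ^+ 6 * S) + 96 * (D ^+ 5 * S)) :> R by ring.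
  rewrite -mulrA; lra.
- rewrite -(ler_nat R) natrD natrM lamE lamS.
  have := hE d; rewrite leqnn d0 ltnn mul0r addr0 => /(_ isT)/andP[_ h1].
  have /andP[h2 _] := hq' d (leqnn d).
  have e0 : excess R d d = 0 by rewrite /excess subrr mulr0 mul0r.
  by rewrite e0 mulr0 addr0 lamS in h1; lra.
- rewrite -(ler_nat R) natrD natrM lamE lamS.
  have := hE d; rewrite leqnn d0 => /(_ isT)/andP[h1 _].
  have /andP[_ h2] := hq' d (leqnn d).
  have e0 : excess R d d = 0 by rewrite /excess subrr mulr0 mul0r.
  by rewrite e0 mulr0 addr0 lamS in h1; lra.
move=> c /andP[c0 cd].
have cd' : (0 < c <= d)%N by rewrite c0 ltnW.
have := hE c cd'; rewrite cd mul1r lamS => /andP[h1 h2].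
have /andP[h3 h4] := hq' c (ltnW cd).
have := excess_bounds cd'; rewrite cd mulr1 => /andP[x1 x2].
have r0 : 0 <= r%:R :> R by [].
have x1' := ler_wpM2l r0 x1; have x2' := ler_wpM2l r0 x2.
have e1 : r%:R * (1%:R / (6 * D)) = 18 * (D ^+ 2 * S) :> R.
  by rewrite pair_number_natr; field; rewrite gt_eqF.
rewrite e1 in x1'.
have XE : (4 * r)%N%:R = 4 * r%:R :> R by rewrite natrM.
rewrite -!(ler_nat R) (natrD _ _ lam') (natrD _ _ (4 * r)) XE lamE lamS.
have rE' := pair_number_natr; move: (r%:R) rE' r0 x1' x2' h1 h2 => x rE' r0 x1' x2' h1 h2.
apply/andP; split; lra.
Qed.
End Random.

(** * Degree profiles and sizes *)

Lemma exists_sqrt_up (n : nat) : (0 < n)%N -> exists s, (n <= s ^ 2)%N /\ (s ^ 2 <= 4 * n)%N.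
Proof.
move=> n0; have ex : exists s, (n <= s ^ 2)%N by exists n; rewrite expnS expn1; nia.
case: (ex_minnP ex) => s ns smin; exists s; split=> //.
rewrite leqNgt; apply/negP => h.
case: s ns smin h => [|s] ns smin h; first by rewrite expnS mul0n in h.
have sn : (s ^ 2 < n)%N by rewrite ltnNge; apply/negP => /smin; rewrite ltnn.
case: s sn h {ns smin} => [|s] sn h; first by rewrite exp1n in h; lia.
have : (s.+2 ^ 2 <= 4 * s.+1 ^ 2)%N.
  by rewrite -[4%N]/(2 ^ 2)%N -expnMn leq_exp2r //; lia.
lia.
Qed.

(** Write n = a (d + 1) + b and let the first b entries be a + 1, the others a. If the parity is
    wrong, moving one unit from entry b - 1 to entry b changes the weighted sum by 1 and keeps the
    values a and a + 1. For b = 0 the unit goes from entry 0 to entry 1, which is allowed because n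
    / (d + 1) = a exactly. *)
Lemma exists_even_profile (R : realFieldType) (n d : nat) : (1 < d)%N -> (d < n)%N ->
  exists q : 'I_d.+1 -> nat, [/\ (\sum_i q i)%N = n,
    ~~ odd (\sum_(i < d.+1) i * q i) &
    forall i, `|(q i)%:R - n%:R / d.+1%:R| <= 1 :> R].
Proof.
move=> d1 dn.
pose a := (n %/ d.+1)%N; pose b := (n %% d.+1)%N.
have nab : n = (a * d.+1 + b)%N := divn_eq n d.+1.
have bd : (b < d.+1)%N by rewrite ltn_mod.
have a1 : (0 < a)%N by rewrite divn_gt0.
clearbody a b.
have near (x : nat) : (a <= x <= a.+1)%N || ((b == 0%N) && (a.-1 <= x <= a.+1)%N) ->
    `|x%:R - n%:R / d.+1%:R| <= 1 :> R.
  move=> hx; have dp : 0 < d.+1%:R :> R by rewrite ltr0n.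
  have nE : n%:R / d.+1%:R = a%:R + b%:R / d.+1%:R :> R.
    by rewrite {1}nab natrD natrM mulrDl mulfK // gt_eqF.
  have b0 : 0 <= b%:R / d.+1%:R :> R by rewrite divr_ge0.
  have b1 : b%:R / d.+1%:R <= 1 :> R by rewrite ler_pdivrMr // mul1r ler_nat ltnW.
  rewrite nE ler_norml; case/orP: hx => [/andP[h1 h2]|/andP[/eqP bz /andP[h1 h2]]].
    have h1' : a%:R <= x%:R :> R by rewrite ler_nat.
    have h2' : x%:R <= a%:R + 1 :> R by rewrite natr1 ler_nat.
    move: (a%:R) (x%:R) (b%:R / d.+1%:R) b0 b1 h1' h2' => u v y b0 b1 h1' h2'. apply/andP; split; lra.
  have h1' : a%:R <= x%:R + 1 :> R by rewrite natr1 ler_nat -(prednK a1) ltnS.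
  have h2' : x%:R <= a%:R + 1 :> R by rewrite natr1 ler_nat.
  by rewrite bz mul0r addr0; apply/andP; split; lra.
pose t := b.-1.
have td : (t.+1 < d.+1)%N by rewrite /t; lia.
pose it := Ordinal (ltnW td); pose it1 := Ordinal td.
pose q1 (i : 'I_d.+1) := (a + (i < b))%N.
pose q2 (i : 'I_d.+1) := (q1 i + (i == it1) - (i == it))%N.
have q12 i : (q2 i + (i == it) = q1 i + (i == it1))%N.
  by rewrite /q2 subnK // /q1; case: eqP => _ //; lia.
have s1 : (\sum_i q1 i)%N = n.
   rewrite big_split /= sum_nat_const card_ord [in RHS]nab mulnC; congr (_ + _)%N.
  by rewrite -big_mkcond /= -(big_ord_widen _ (fun=> 1%N) (ltnW bd)) sum1_card card_ord.
have delta (F : nat -> nat) (k : 'I_d.+1) : (\sum_(i < d.+1) F i * (i == k))%N = F k.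
  by rewrite (bigD1 k) //= eqxx muln1 big1 ?addn0 // => i /negPf->; rewrite muln0.
have one (k : 'I_d.+1) : (\sum_(i < d.+1) (i == k))%N = 1%N.
  by rewrite -[RHS](delta (fun=> 1%N) k); apply: eq_bigr => i _; rewrite mul1n.
have s2 : (\sum_i q2 i)%N = n.
  have : (\sum_i (q2 i + (i == it)) = \sum_i (q1 i + (i == it1)))%N.
    by apply: eq_bigr => i _.
  by rewrite [LHS]big_split [RHS]big_split /= s1 !one => /addIn.
have o12 : odd (\sum_(i < d.+1) i * q1 i) = ~~ odd (\sum_(i < d.+1) i * q2 i).
  have : (\sum_(i < d.+1) (i * q2 i + i * (i == it)) =
          \sum_(i < d.+1) (i * q1 i + i * (i == it1)))%N.
    by apply: eq_bigr => i _; rewrite -!mulnDr q12.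
  rewrite [LHS]big_split [RHS]big_split /= (delta id it) (delta id it1) /=; lia.
have n1 i : `|(q1 i)%:R - n%:R / d.+1%:R| <= 1 :> R.
  by apply: near; rewrite /q1; case: (i < b)%N; lia.
have n2 i : `|(q2 i)%:R - n%:R / d.+1%:R| <= 1 :> R.
  apply: near; have := q12 i; rewrite /q1 -!val_eqE /=; move: (q2 i) => y.
  by rewrite /t; case: (posnP b) => b0; lia.
by case e1: (odd (\sum_(i < d.+1) i * q1 i)); [exists q2 | exists q1]; split; rewrite // ?e1 // -[~~ _]o12.
Qed.

(** For large n the factor n^(12 eps) exceeds 2^60, while d^12 <= n^(1 - 12 eps). *)
Lemma powR_bound (R : realType) (eps : R) : 0 < eps ->
  exists n0 : nat, forall n d : nat, (n0 <= n)%N ->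
    d%:R <= n%:R `^ (1 / 12%:R - eps) -> (0 < n)%N /\ 2 ^+ 60 * d%:R ^+ 12 <= n%:R :> R.
Proof.
move=> eps0; pose x : R := (2 ^+ 60) `^ (12 * eps)^-1.
have e12 : 0 < 12 * eps by lra.
exists (Num.truncn x).+1 => n d hn hd.
have n0 : (0 < n)%N by apply: leq_trans hn.
split=> //.
have nR : 0 < n%:R :> R by rewrite ltr0n.
have xn : x <= n%:R by apply: ltW; apply: lt_le_trans (truncnS_gt _) _; rewrite ler_nat.
have h1 : 2 ^+ 60 <= n%:R `^ (12 * eps).
  have -> : 2 ^+ 60 = x `^ (12 * eps).
    by rewrite -powRrM mulVf ?gt_eqF // powRr1 // exprn_ge0.
  by apply: ge0_ler_powR; rewrite ?nnegrE ?powR_ge0 // ltW.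
have h2 : d%:R ^+ 12 <= n%:R `^ (1 - 12 * eps).
  have -> : 1 - 12 * eps = (1 / 12%:R - eps) * 12%:R by field.
  rewrite powRrM powR_mulrn ?powR_ge0 //.
  by apply: lerXn2r; rewrite ?nnegrE ?powR_ge0.
apply: (@le_trans _ _ (n%:R `^ (12 * eps) * n%:R `^ (1 - 12 * eps))).
  by apply: ler_pM; rewrite ?exprn_ge0.
rewrite -powRD; last by rewrite (gt_eqF nR) implybT.
by rewrite addrC subrK powRr1 // ltW.
Qed.

Theorem theorem2p1 (R : realType) (eps : R) (heps : 0 < eps) :
  exists n0 : nat,
    forall (T : finType) (g : rel T) (d : nat),
      simple_graph g ->
      regular_graph g d ->
      (n0 <= #|T|)%N ->
      (2 <= d)%N ->
      d%:R <= #|T|%:R `^ (1 / 12%:R - eps) ->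
      (forall q : 'I_d.+1 -> nat,
         (\sum_(i < d.+1) q i)%N = #|T| ->
         (\sum_(i < d.+1) i * q i)%N = 0 %[mod 2] ->
         (forall i : 'I_d.+1, `|(q i)%:R - #|T|%:R / d.+1%:R| <= 1 :> R) ->
         exists2 h : rel T, spanning_subgraph h g &
           forall i : 'I_d.+1, degree_count h i = q i)
      /\
      (exists2 h : rel T, spanning_subgraph h g &
         forall i : 'I_d.+1,
           `|(degree_count h i)%:R - #|T|%:R / d.+1%:R| <= 1 :> R).
Proof.
have [n0 hn0] := powR_bound heps.
exists n0 => T g d gg rg nT d2 dn.
have [T0 big] := hn0 _ _ nT dn.
have [s [ns sn]] := exists_sqrt_up T0.
have D2 : 2 <= d%:R :> R by rewrite ler_nat.
have N0 : 0 < #|T|%:R :> R by rewrite ltr0n.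
have NS : #|T|%:R <= s%:R ^+ 2 :> R by rewrite -natrX ler_nat.
have SN : s%:R ^+ 2 <= 4 * #|T|%:R :> R by rewrite -natrX -natrM ler_nat.
(* After squaring, s^2 <= 4 n reduces the claim to 2^52 d^12 < n. *)
have KN : 2 ^+ 25 * d%:R ^+ 6 * s%:R < #|T|%:R :> R.
  have x0 : 0 <= 2 ^+ 25 * d%:R ^+ 6 * s%:R :> R by rewrite !mulr_ge0 ?exprn_ge0.
  rewrite -(ltr_pXn2r (ltn0Sn 1)) ?nnegrE ?(ltW N0) //.
  have -> : (2 ^+ 25 * d%:R ^+ 6 * s%:R) ^+ 2 = 2 ^+ 50 * d%:R ^+ 12 * s%:R ^+ 2 :> R by ring.
  have k0 : 0 < 2 ^+ 50 * d%:R ^+ 12 :> R by rewrite mulr_gt0 ?exprn_gt0 //; lra.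
  apply: le_lt_trans (ler_wpM2l (ltW k0) SN) _.
  rewrite mulrA expr2 ltr_pM2r //; lra.
have exact q := exists_exact_degrees gg rg d2 NS KN (q := q).
split=> [q sq eq hq|].
  by apply: exact => //; rewrite -dvdn2 /dvdn eq.
have dT : (d < #|T|)%N.
  have /card_gt0P[v _] := T0; rewrite -(rg v) -cardsT; apply: proper_card.
  by apply/properP; split; [apply: subsetT | exists v; rewrite ?inE // (proj2 gg)].
have [q [sq eq hq]] := exists_even_profile R d2 dT.
by have [h sph hE] := exact q sq eq hq; exists h => // i; rewrite hE.
Qed.
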